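(* There is an open neighborhood $\boldsymbol{\mathcal U}\subset\mathcal T_\Lambda$ of $T_{\mathcal X}$ with the following properties. (a) If $T\in\boldsymbol{\mathcal U}$ then $\mathbf W(T)\in\boldsymbol{\mathcal U}$. (b) If $T_0\in\boldsymbol{\mathcal U}$ then the sequence $T_k=\mathbf W^k(T_0)$ converges to a matrix $T_\infty$ with $(T_\infty)_{23}=0$. If $T_\infty=T_{\mathcal X}$ then the convergence rate of $(T_k)_{23}$ to $0$ is strictly quadratic; otherwise it is strictly cubic. (c) Let $\boldsymbol{\mathcal X}\subset\boldsymbol{\mathcal U}$ be the set of initial conditions $T_0$ for which $T_\infty=T_{\mathcal X}$. Then $\boldsymbol{\mathcal X}$ is the union of arcs $\boldsymbol{\mathcal X}^\sigma$, $\sigma\in\Sigma$, which are disjoint except for the common point $T_{\mathcal X}$. Also, $\mathbf W(\boldsymbol{\mathcal X}^\sigma)\subseteq\boldsymbol{\mathcal X}^{\sigma^\sharp}$ for all $\sigma\in\Sigma$. (d) The set $\boldsymbol{\mathcal X}\subset\boldsymbol{\mathcal U}$ has Hausdorff dimension $1$.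
   Context: Let $\mathcal T$ be the vector space of real symmetric tridiagonal $3\times3$ matrices, $\Lambda=\operatorname{diag}(1,-1,0)$, and $\mathcal T_\Lambda$ the set of matrices in $\mathcal T$ similar to $\Lambda$. Let $T_{\mathcal X}=\begin{pmatrix}0&1&0\\1&0&0\\0&0&0\end{pmatrix}\in\mathcal T_\Lambda$. Shifted step: if $T\in\mathcal T_\Lambda$ and $T-sI$ is invertible with QR decomposition $T-sI=QR$ ($Q$ orthogonal, $R$ upper triangular with positive diagonal), then $\mathbf F(s,T)=Q^{*}TQ=RTR^{-1}\in\mathcal T_\Lambda$. For $s$ near $0$, $s\ne 0$, and $T\in \mathcal T_\Lambda$ near $T_{\mathcal X}$, $\mathbf F$ is defined, and it extends continuously to $s=0$; $\mathbf F(0,T)$ denotes this continuous extension. Wilkinson's step: let $\boldsymbol\omega_-(T)\le\boldsymbol\omega_+(T)$ be the eigenvalues of the bottom $2\times2$ diagonal block of $T$ (rows and columns $2,3$), and let $\boldsymbol\omega(T)$ be the one of them closer to $T_{33}$, with the convention $\boldsymbol\omega(T)=\boldsymbol\omega_+(T)$ in case of a tie. Wilkinson's step is $\mathbf W(T)=\mathbf F(\boldsymbol\omega(T),T)$, for $T\in\mathcal T_\Lambda$ near $T_{\mathcal X}$ (when $\boldsymbol\omega(T)=0$, this means $\mathbf W(T)=\mathbf F(0,T)=\lim_{s\to0,\,s\ne0}\mathbf F(s,T)$, the value at $s=0$ of the continuous extension of $\mathbf F$). Rates: a sequence of reals $(y_k)_{k\ge0}$ (here $y_k=(T_k)_{23}$)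 has strictly quadratic (resp. strictly cubic) convergence to $0$ if it tends to $0$ and there are constants $c,C>0$ such that $c|y_k|^r\le|y_{k+1}|\le C|y_k|^r$ for all $k\in\mathbb N$, with $r=2$ (resp. $r=3$). $\Sigma$ is the set of infinite sign sequences $\sigma:\mathbb N\to\{+,-\}$ ($\mathbb N=\{0,1,2,\dots\}$), and $\sigma^\sharp\in\Sigma$ is given by $\sigma^\sharp(n)=\sigma(n+1)$. An arc is a set homeomorphic to a non-degenerate interval. Hausdorff dimension is taken with respect to the Euclidean metric on matrices. *)

(* Defs.v *)
From HB Require Import structures.
From mathcomp Require Import all_boot all_order all_algebra.
From mathcomp Require Import all_classical all_reals all_analysis.
Set Implicit Arguments.
Unset Strict Implicit.
Unset Printing Implicit Defensive.
Import Order.TTheory GRing.Theory Num.Theory.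
Import numFieldNormedType.Exports.
Local Open Scope classical_set_scope.
Local Open Scope ring_scope.

(* Rows and columns are numbered from 0: [T 1 2] is the entry written T_23. *)

Section Matrices.
Variable R : realType.
Implicit Types (s : R) (T Q U : 'M[R]_3).

Definition symmetric_mx T : Prop := T^T = T.

Definition tridiagonal T : Prop :=
  forall i j : 'I_3, (i.+1 < j)%N || (j.+1 < i)%N -> T i j = 0.

Definition Lambda : 'M[R]_3 := diag_mx (\row_(j < 3) [:: 1; -1; 0]`_j).

Definition T_Lambda : set 'M[R]_3 :=
  [set T | [/\ symmetric_mx T, tridiagonal T & similar_in unitmx T Lambda]].

Definition T_X : 'M[R]_3 := delta_mx 0 1 + delta_mx 1 0.

Definition orthogonal_mx Q : Prop := Q^T *m Q = 1%:M.

Definition upper_triangular U : Prop :=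
  forall i j : 'I_3, (j < i)%N -> U i j = 0.

Definition is_QR (A Q U : 'M[R]_3) : Prop :=
  [/\ A = Q *m U, orthogonal_mx Q, upper_triangular U
    & forall i, 0 < U i i].

(* A QR decomposition of [T - s%:M] in the sense of [is_QR] exists iff this
   matrix is invertible, and is then unique; otherwise the value is the
   irrelevant default 0, which is not in [T_Lambda]. *)
Definition qr_step s T : 'M[R]_3 :=
  xget 0 [set T' | exists Q U,
                     is_QR (T - s%:M) Q U /\ T' = Q^T *m T *m Q].

(* For T in [T_Lambda] the matrix T - 0 I is singular: the step at s = 0 is
   the continuous extension. *)
Definition shifted_step s T : 'M[R]_3 :=
  if s == 0 then lim (qr_step s' T @[s' --> (0 : R)^']) else qr_step s T.

Definition bottom_block T : 'M[R]_2 := row' 0 (col' 0 T).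

Definition block_spectrum T : set R :=
  [set a | a \in eigenvalue (bottom_block T)].

(* For T symmetric the spectrum is finite and nonempty, so these are the
   smallest and the largest eigenvalue (equal if it is a double one). *)
Definition omega_minus T : R := inf (block_spectrum T).
Definition omega_plus T : R := sup (block_spectrum T).

Definition omega T : R :=
  if `|omega_minus T - T 2 2| < `|omega_plus T - T 2 2|
  then omega_minus T else omega_plus T.

Definition wilkinson T : 'M[R]_3 := shifted_step (omega T) T.

Definition frobenius_dist (A B : 'M[R]_3) : R :=
  Num.sqrt (\sum_i \sum_j (A i j - B i j) ^+ 2).

Definition is_arc (A : set 'M[R]_3) : Prop :=
  exists (I : set R) (f : R -> 'M[R]_3) (g : 'M[R]_3 -> R),
    [/\ is_interval I /\ (exists x y, [/\ I x, I y & x < y]),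
        set_bij I A f,
        {in I, cancel f g},
        {within I, continuous f}
      & {within A, continuous g}].

Definition strict_rate (r : nat) (y : nat -> R) : Prop :=
  y k @[k --> \oo] --> (0 : R) /\
  exists c C : R, [/\ 0 < c, 0 < C &
    forall k, c * `|y k| ^+ r <= `|y k.+1| <= C * `|y k| ^+ r].

End Matrices.

Definition sign_seq := nat -> bool.
Definition sharp (sigma : sign_seq) : sign_seq := fun n => sigma n.+1.

Section Hausdorff.
Local Open Scope ereal_scope.
Variables (R : realType) (M : Type) (dist : M -> M -> R).
Implicit Types (d : R) (A : set M).

Definition diam A : \bar R :=
  ereal_sup [set (dist p.1 p.2)%:E | p in A `*` A].

(* The empty set weighs 0 also for d = 0, while a point then weighs 0^0 = 1. *)
Definition hausdorff_weight d A : \bar R :=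
  if A == set0 then 0 else diam A `^ d.

Definition hausdorff_content d (delta : R) A : \bar R :=
  ereal_inf [set \sum_(0 <= k <oo) hausdorff_weight d (F k) |
    F in [set F : nat -> set M |
            A `<=` \bigcup_k F k /\ forall k, diam (F k) <= delta%:E]].

Definition hausdorff_measure d A : \bar R :=
  ereal_sup [set hausdorff_content d delta A | delta in [set e : R | (0 < e)%R]].

Definition hausdorff_dim A : \bar R :=
  ereal_inf [set d%:E | d in [set d : R | (0 <= d)%R /\
                                          hausdorff_measure d A = 0]].

End Hausdorff.

(* Main.v *)
(** Parametrize the tridiagonal matrices with spectrum {1, -1, 0} near T_X by the
    first components of their unit eigenvectors, taken proportional to
    (1 + h, 1 - h, k) with h, k small; T_X is (h, k) = (0, 0) and T_23 is comparable
    to k. A QR step with shift s multiplies these components by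
    |1 - s|, |-1 - s|, |s|, so it becomes the rational map
    (h, k) |-> ((h - s) / (1 - s h), |s| k / (1 - s h)). The eigenvalues s of the bottom
    block are the roots of (2 + 2 h^2 + k^2) s^2 + 4 h s - k^2 = 0, and Wilkinson's
    choice is the root which has the sign of h (the positive one for h = 0).

    The increment of h is at most the decrement of |k|, which gives convergence;
    s is comparable to k^2 / |h| if h does not tend to 0 (cubic rate), and |h| <= |k|
    along the whole orbit if h tends to 0, so that s is comparable to k (quadratic
    rate). Among points with |h| <= |k|, a step expands horizontal differences as
    long as the signs of h agree, and contracts k. Hence the points converging to T_X
    with a prescribed sequence of signs of h form a Lipschitz graph over |k|,
    obtained as a limit of the graph transform. Agreement of n signs forces two such
    points with the same k to be 2^(1-2^n)-close, so 2^n families of graphs can be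
    covered economically enough to give dimension 1. *)
Require Import Defs.
From HB Require Import structures.
From mathcomp Require Import all_boot all_order all_algebra.
From mathcomp Require Import all_classical all_reals all_analysis.
From mathcomp Require Import ring lra.
Set Implicit Arguments.
Unset Strict Implicit.
Unset Printing Implicit Defensive.
Import Order.TTheory GRing.Theory Num.Theory.
Import numFieldNormedType.Exports.
Local Open Scope classical_set_scope.
Local Open Scope ring_scope.

(** * The map in the coordinates (h, k) *)

Section Plane.
Variable R : realType.
Implicit Types (h u k s : R) (p q : R * R) (sigma tau : sign_seq) (n m : nat).

(** Wilkinson's choice makes the step jump across h = 0, and the line k = 0 consists of fixed
    points, so T_X is not a hyperbolic fixed point of a smooth map. The remedy is to follow one sign
    of h at a time. On the cone [|h| <= |k|] the size s of the shift decreases as u = [|h|] grows,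
    so u - s expands differences in u. Moreover this branch carries the segment from [|k| / 4] to
    [|k|] across the whole cone at the next height. Hence any sign can be followed by any sign, and
    every sign sequence gets a curve.

    The drift inequality also controls the tail of an orbit: h stays within [|k|] of its limit. So h
    tends to 0 exactly when [|h| <= |k|] at all times, a condition on single iterates to which
    expansion can be applied.

    The numerical constants come from one scaling: in the box D1 is nearly 2, so x = s / [|k|]
    nearly solves 2 x^2 + 4 (u / [|k|]) x = 1. Its positive root decreases from 0.7071 at u = 0
    through 0.5 at u = [|k| / 4] to 0.2247 at u = [|k|]. *)

Definition D1 h k : R := 2 + 2 * h ^+ 2 + k ^+ 2.

(* The nonnegative root s of [D1 u k * s ^+ 2 + 4 * u * s = k ^+ 2]: Wilkinson's
   shift at (h, k) is the root with the sign of h, at [u = `|h|]. *)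
Definition wshift u k : R :=
  (Num.sqrt (4 * u ^+ 2 + D1 u k * k ^+ 2) - 2 * u) / D1 u k.

Definition nextu u k : R := (u - wshift u k) / (1 - wshift u k * u).

Definition nextk u k : R := wshift u k * k / (1 - wshift u k * u).

Definition sg (b : bool) : R := if b then 1 else -1.

Definition step p : R * R :=
  (sg (0 <= p.1) * nextu `|p.1| p.2, nextk `|p.1| p.2).

(* Any sufficiently small value would do. *)
Definition radius : R := (100 * 100)^-1.

Definition in_box p : Prop := `|p.1| < radius /\ `|p.2| < radius.

Lemma radiusE : 100 * 100 * radius = 1.
Proof. by rewrite /radius divff // mulf_neq0 // pnatr_eq0. Qed.

Lemma radius_gt0 : 0 < radius.
Proof. by rewrite invr_gt0 mulr_gt0 // ltr0n. Qed.

Lemma radius_ge0 : 0 <= radius.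
Proof. exact: ltW radius_gt0. Qed.

Lemma D1_ge2 u k : 2 <= D1 u k.
Proof. by rewrite /D1; have := sqr_ge0 u; have := sqr_ge0 k; lra. Qed.

Lemma D1_gt0 u k : 0 < D1 u k.
Proof. by have := D1_ge2 u k; lra. Qed.

Lemma wshiftP u k : 0 <= u ->
  D1 u k * wshift u k ^+ 2 + 4 * u * wshift u k = k ^+ 2.
Proof.
move=> u0; have A0 := D1_gt0 u k; rewrite /wshift.
set A := D1 u k in A0 *; set q := Num.sqrt _.
have qE : q ^+ 2 = 4 * u ^+ 2 + A * k ^+ 2.
  by rewrite sqr_sqrtr // addr_ge0 // mulr_ge0 ?sqr_ge0 // ltW.
have -> : A * ((q - 2 * u) / A) ^+ 2 + 4 * u * ((q - 2 * u) / A) =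
    (q ^+ 2 - 4 * u ^+ 2) / A by field; rewrite gt_eqF.
by rewrite qE; field; rewrite gt_eqF.
Qed.

Lemma wshift_ge0 u k : 0 <= u -> 0 <= wshift u k.
Proof.
move=> u0; have A0 := D1_gt0 u k; apply: divr_ge0; last exact: ltW.
rewrite subr_ge0 -[leLHS]ger0_norm ?mulr_ge0// -sqrtr_sqr ler_wsqrtr//.
have -> : (2 * u) ^+ 2 = 4 * u ^+ 2 by ring.
by rewrite lerDl mulr_ge0 ?sqr_ge0 // ltW.
Qed.

Lemma wshift_abs u k : wshift u `|k| = wshift u k.
Proof. by rewrite /wshift /D1 !real_normK ?num_real. Qed.

Lemma nextu_abs u k : nextu u `|k| = nextu u k.
Proof. by rewrite /nextu wshift_abs. Qed.

Lemma wshift_eq0 u k : 0 <= u -> (wshift u k == 0) = (k == 0).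
Proof.
move=> u0; have E := wshiftP k u0; have s0 := wshift_ge0 k u0.
apply/eqP/eqP => [s|k0].
  by move: E; rewrite s => /esym/eqP; rewrite expr0n /= !mulr0 addr0 sqrf_eq0 => /eqP.
move: E; rewrite k0 expr0n /= => E.
have A0 := D1_ge2 u 0; have := sqr_ge0 (wshift u 0).
move: s0; rewrite k0 => s0 ss.
have : wshift u 0 ^+ 2 = 0 by nra.
by move=> /eqP; rewrite sqrf_eq0 => /eqP.
Qed.

Lemma wshift0 u : 0 <= u -> wshift u 0 = 0.
Proof. by move=> u0; apply/eqP; rewrite wshift_eq0. Qed.

(** Dropping the nonnegative term [4 * u * s] and using [2 <= D1 u k] leaves 2 s^2 <= k^2; 71/100 is
    just above 1 / sqrt 2. *)
Lemma wshift_upper u k : 0 <= u -> wshift u k <= 71 / 100 * `|k|.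
Proof.
move=> u0; have E := wshiftP k u0; have s0 := wshift_ge0 k u0.
rewrite -ler_sqr ?nnegrE// ?mulr_ge0//.
rewrite [leRHS]exprMn real_normK ?num_real//.
have A0 := D1_ge2 u k; have := sqr_ge0 (wshift u k).
by have := mulr_ge0 u0 s0; nra.
Qed.

(** The worst case is u = |k|, where s / |k| is nearly sqrt 6 / 2 - 1 = 0.2247. *)
Lemma wshift_lower u k : 0 <= u -> u <= `|k| -> `|k| <= radius ->
  22 / 100 * `|k| <= wshift u k.
Proof.
move=> u0 uk kr; rewrite leNgt; apply/negP => lt.
have E := wshiftP k u0; have s0 := wshift_ge0 k u0.
have kr' := radiusE; have k0 := normr_ge0 k.
have kE : `|k| ^+ 2 = k ^+ 2 by rewrite real_normK ?num_real.
rewrite -kE /D1 -kE in E.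
move: (wshift u k) (`|k|) E s0 lt uk kr k0 {kE} => s c E s0 lt uk kr c0.
have c1 : c <= 1/100 by lra.
have s2 : s ^+ 2 <= (22/100) ^+ 2 * c ^+ 2 by nra.
have us : u * s <= 22/100 * c ^+ 2 by nra.
have c2 : c ^+ 2 <= 1/ (100 * 100) by nra.
have u2 : u ^+ 2 <= c ^+ 2 by nra.
have cp : 0 < c by lra.
have cc : 0 < c ^+ 2 by rewrite exprn_gt0.
nra.
Qed.

Lemma den_bounds u k : 0 <= u -> u <= radius -> `|k| <= radius ->
  99 / 100 <= 1 - wshift u k * u <= 1.
Proof.
move=> u0 ur kr; have s0 := wshift_ge0 k u0; have su := wshift_upper k u0.
have rE := radiusE; have := mulr_ge0 s0 u0.
have : wshift u k <= 1 by lra.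
by move=> s1 p0; apply/andP; split; nra.
Qed.
End Plane.

Arguments radius {R}.
Arguments sg {R} b.
Arguments step {R} p.

(** * Orbits in the box: convergence and trapped points *)

Section PlaneStep.
Variable R : realType.
Implicit Types (h u k s : R) (p q : R * R) (sigma tau : sign_seq) (n m : nat).

Lemma nextu_bounds u k : 0 <= u -> u <= radius -> `|k| <= radius ->
  - wshift u k <= nextu u k <= u.
Proof.
move=> u0 ur kr; have /andP[d0 d1] := den_bounds u0 ur kr.
have s0 := wshift_ge0 k u0; have su := wshift_upper k u0; have rE := @radiusE R.
have p0 := mulr_ge0 s0 u0.
rewrite /nextu; move: (wshift u k) d0 d1 s0 su p0 => s d0 d1 s0 su p0.
have dp : 0 < 1 - s * u by lra.
rewrite ler_pdivlMr// ler_pdivrMr//; apply/andP; split; nra.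
Qed.

Lemma nextk_bound u k : 0 <= u -> u <= radius -> `|k| <= radius ->
  `|nextk u k| <= k ^+ 2.
Proof.
move=> u0 ur kr; have /andP[d0 d1] := den_bounds u0 ur kr.
have s0 := wshift_ge0 k u0; have su := wshift_upper k u0.
have k0 := normr_ge0 k.
have dp : 0 < 1 - wshift u k * u by lra.
rewrite /nextk normrM normfV normrM (gtr0_norm dp) (ger0_norm s0).
rewrite ler_pdivrMr// -[k ^+ 2]real_normK ?num_real//; nra.
Qed.

(** The shift moves u by about s, at most 71/100 of |k|, while the new |k| is only of order k^2: the
    loss in |k| pays for the move. *)
Lemma nextu_drift u k : 0 <= u -> u <= radius -> `|k| <= radius ->
  `|nextu u k - u| <= `|k| - `|nextk u k|.
Proof.
move=> u0 ur kr; have /andP[d0 d1] := den_bounds u0 ur kr.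
have s0 := wshift_ge0 k u0; have su := wshift_upper k u0.
have kb := nextk_bound u0 ur kr; have rE := @radiusE R.
have k0 := normr_ge0 k; rewrite -[k ^+ 2]real_normK ?num_real// in kb.
have kk : `|nextk u k| <= 1 / 100 * `|k| by nra.
suff : `|nextu u k - u| <= 99 / 100 * `|k| by lra.
have dp : 0 < 1 - wshift u k * u by lra.
have -> : nextu u k - u = - (wshift u k * (1 - u ^+ 2) / (1 - wshift u k * u)).
  by rewrite /nextu; field; rewrite gt_eqF.
have u1 : 0 <= 1 - u ^+ 2 by nra.
rewrite normrN ger0_norm; last exact: divr_ge0 (mulr_ge0 s0 u1) (ltW dp).
by rewrite ler_pdivrMr//; nra.
Qed.

Lemma sg_norm b : `|sg b| = 1 :> R.
Proof. by case: b; rewrite /sg ?normrN normr1. Qed.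

Lemma sg_sq b : sg b * sg b = 1 :> R.
Proof. by case: b; rewrite /sg ?mulrNN mulr1. Qed.

Lemma sg_abs h : sg (0 <= h) * `|h| = h.
Proof.
rewrite /sg; case: ifPn => [h0|]; first by rewrite mul1r ger0_norm.
by rewrite -ltNge => h0; rewrite mulN1r ltr0_norm// opprK.
Qed.

Lemma normr_nextk u k : 0 <= u -> u <= radius -> `|k| <= radius ->
  `|nextk u k| = nextk u `|k|.
Proof.
move=> u0 ur kr; have /andP[d0 d1] := den_bounds u0 ur kr.
have s0 := wshift_ge0 k u0.
have dp : 0 < 1 - wshift u k * u by lra.
by rewrite /nextk wshift_abs normrM normfV normrM (gtr0_norm dp) (ger0_norm s0).
Qed.

(** The reflection k -> -k is a symmetry of the step, so orbit arguments may assume that k is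
    nonnegative. *)
Definition fold p : R * R := (p.1, `|p.2|).

Lemma in_box_fold p : in_box p -> in_box (fold p).
Proof. by case: p => h k [? ?]; split; rewrite /= ?normr_id. Qed.

Lemma step_fold p : in_box p -> step (fold p) = fold (step p).
Proof.
case: p => h k [/= hr kr]; rewrite /step /fold /= nextu_abs.
by rewrite normr_nextk // ltW.
Qed.

Lemma step_k_bound p : in_box p -> `|(step p).2| <= p.2 ^+ 2.
Proof. by case: p => h k [/= hr kr]; apply: nextk_bound => //; apply: ltW. Qed.

Lemma step_drift p : in_box p ->
  `|(step p).1 - p.1| <= `|p.2| - `|(step p).2|.
Proof.
case: p => h k [/= hr kr].
rewrite -{3}(sg_abs h) -mulrBr normrM sg_norm mul1r.
by apply: nextu_drift => //; apply: ltW.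
Qed.

Lemma step_box p : in_box p -> in_box (step p).
Proof.
move=> pb; case: (pb) => hr kr; have k0 := normr_ge0 p.2.
have rE := @radiusE R.
split; last first.
  apply: le_lt_trans (step_k_bound pb) _.
  by rewrite -[p.2 ^+ 2]real_normK ?num_real//; nra.
rewrite /= normrM sg_norm mul1r.
have h0 := normr_ge0 p.1.
have /andP[l r] := nextu_bounds h0 (ltW hr) (ltW kr).
have su := wshift_upper p.2 h0.
by rewrite ltr_norml; apply/andP; split; lra.
Qed.

Lemma iter_box n p : in_box p -> in_box (iter n step p).
Proof. by move=> pb; elim: n => //= n; apply: step_box. Qed.

Lemma iter_fold n p : in_box p -> iter n step (fold p) = fold (iter n step p).
Proof.
by move=> pb; elim: n => //= n ->; rewrite step_fold//; apply: iter_box.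
Qed.

(** Each step at least squares the small number |k|. This doubly exponential decay is what later
    outweighs the number 2^n of sign prefixes. *)
Lemma iter_k_bound n p : in_box p ->
  `|(iter n step p).2| <= (1 / 2) ^+ (2 ^ n).
Proof.
move=> pb; elim: n => [|n IH] /=.
  by case: pb => _ kr; have := @radiusE R; rewrite expn0 expr1; lra.
apply: le_trans (step_k_bound (iter_box n pb)) _.
rewrite expnS mulnC exprM -[leLHS]real_normK ?num_real//.
by rewrite lerXn2r ?nnegrE// exprn_ge0//; lra.
Qed.

Lemma half_expn_le n : (1 / 2 : R) ^+ (2 ^ n) <= (1 / 2) ^+ n.
Proof.
apply: ler_wiXn2l; [lra|lra|]; exact/ltnW/ltn_expl.
Qed.

Lemma half_cvg0 (C : R) : (C * (1 / 2) ^+ n : R) @[n --> \oo] --> (0 : R).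
Proof.
rewrite -[X in _ --> X](mulr0 C); apply: cvgMr.
by apply: cvg_expr; rewrite ger0_norm; lra.
Qed.

(* [x n + y n] is nonincreasing and bounded below. *)
Lemma drift_cvg (x y : nat -> R) :
  (forall n, `|x n.+1 - x n| <= y n - y n.+1) -> (forall n, 0 <= y n) ->
  exists l : R, x @ \oo --> l /\ (y @ \oo --> (0 : R) -> forall n, `|x n - l| <= y n).
Proof.
move=> dxy y0.
have dn n m : (n <= m)%N -> `|x m - x n| <= y n - y m.
  move=> /subnKC <-; elim: (m - n)%N => [|j IH].
    by rewrite addn0 !subrr normr0.
  rewrite addnS; have := dxy (n + j)%N.
  by have := ler_distD (x (n + j)%N) (x (n + j).+1) (x n); lra.
have ycvg : cvgn y.
  apply: nonincreasing_is_cvgn.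
    apply/nonincreasing_seqP => n; have := dxy n.
    by have := normr_ge0 (x n.+1 - x n); lra.
  by exists 0 => _ [n _ <-].
have scvg : cvgn (fun n => x n + y n).
  apply: nonincreasing_is_cvgn.
    by apply/nonincreasing_seqP => n; have := dxy n; rewrite ler_norml; lra.
  exists (x 0%N - y 0%N) => _ [n _ <-].
  by have := dn 0%N n (leq0n n); have := y0 n; rewrite ler_norml; lra.
have xl : x @ \oo --> limn (fun n => x n + y n) - limn y.
  have xE : (fun n => (x n + y n) - y n) = x by apply/funext => n; ring.
  by rewrite -[X in X @ _]xE; apply: cvgB; [exact: scvg|exact: ycvg].
exists (limn (fun n => x n + y n) - limn y); split=> // yl0 n.
set l := limn _ - _ in xl *.
have xn : (fun m => `|x n - x m|) @ \oo --> `|x n - l|.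
  by apply: cvg_norm; apply: cvgB => //; exact: cvg_cst.
rewrite -(cvg_lim _ xn)//.
apply: limr_le; first by apply/cvg_ex; exists `|x n - l|.
near=> m; have nm : (n <= m)%N by near: m; exact: nbhs_infty_ge.
by have := dn _ _ nm; have := y0 m; rewrite distrC; lra.
Unshelve. all: by end_near.
Qed.

Lemma iter_k_cvg p : in_box p -> (iter n step p).2 @[n --> \oo] --> (0 : R).
Proof.
move=> pb; apply/norm_cvg0P.
apply: (@squeeze_cvgr _ _ _ _ (fun=> 0) (fun n => 1 * (1 / 2) ^+ n)).
- apply: nearW => n; rewrite normr_ge0 /= mul1r.
  exact: le_trans (iter_k_bound n pb) (half_expn_le n).
- exact: cvg_cst.
- exact: half_cvg0.
Qed.

Lemma orbit_cvg p : in_box p -> exists l : R,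
  (iter n step p).1 @[n --> \oo] --> l /\
  forall n, `|(iter n step p).1 - l| <= `|(iter n step p).2|.
Proof.
move=> pb.
have [l [xl H]] := @drift_cvg (fun n => (iter n step p).1)
   (fun n => `|(iter n step p).2|)
   (fun n => step_drift (iter_box n pb)) (fun n => normr_ge0 _).
by exists l; split=> //; apply: H; apply/norm_cvg0P; exact: iter_k_cvg.
Qed.

(** Convergence to T_X without a limit: by the tail bound of [orbit_cvg], h tends to 0 iff this
    inequality holds at each time. *)
Definition trapped p : Prop :=
  forall n, `|(iter n step p).1| <= `|(iter n step p).2|.

Lemma trappedP p : in_box p ->
  trapped p <-> (iter n step p).1 @[n --> \oo] --> (0 : R).
Proof.
move=> pb; have [l [xl H]] := orbit_cvg pb; split=> [tr|x0].
  apply/norm_cvg0P.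
  apply: (@squeeze_cvgr _ _ _ _ (fun=> 0) (fun n => `|(iter n step p).2|)).
  - by apply: nearW => n; rewrite normr_ge0 /=; exact: tr.
  - exact: cvg_cst.
  - by apply/norm_cvg0P; exact: iter_k_cvg.
have l0 : l = 0 by apply: cvg_unique xl x0; exact: Rhausdorff.
by move=> n; have := H n; rewrite l0 subr0.
Qed.

Lemma trapped_step p : trapped p -> trapped (step p).
Proof. by move=> tr n; have := tr n.+1; rewrite !iterSr. Qed.

Lemma trapped_fold p : in_box p -> trapped (fold p) <-> trapped p.
Proof.
by move=> pb; split=> tr n; have := tr n; rewrite iter_fold//= normr_id.
Qed.

End PlaneStep.

(** * Expansion of horizontal differences *)

Section PlaneExpansion.
Variable R : realType.
Implicit Types (h u v k c s t a b x y e f : R).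

Lemma mulr_itv x y e f : 0 <= x <= e -> 0 <= y <= f -> 0 <= x * y <= e * f.
Proof.
by move=> /andP[x0 xe] /andP[y0 yf]; rewrite mulr_ge0//= ler_pM.
Qed.

(* Subtracting the two quadratic equations for the shift expresses [s - t]
   linearly in [u - v] and [k - c], with explicit coefficients. *)
Lemma quadratic_diff A B u v k c s t : 2 <= A <= 2 + 1 / 100 ->
    A * s ^+ 2 + 4 * u * s = k ^+ 2 -> B * t ^+ 2 + 4 * v * t = c ^+ 2 ->
    A - B = 2 * (u - v) * (u + v) + (k - c) * (k + c) ->
    0 <= u <= k -> 0 <= v <= c -> 0 < k <= 1 / (100 * 100) -> 0 < c <= 1 / (100 * 100) ->
    22 / 100 * k <= s <= 71 / 100 * k -> 22 / 100 * c <= t <= 71 / 100 * c ->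
    49 * k <= 51 * c ->
  exists a b, [/\ s - t = a * (k - c) - b * (u - v),
    0 <= a <= 23 / 10 & 12 / 100 <= b <= 201 / 100].
Proof.
move=> /andP[A2 A3] Es Et AB /andP[u0 uk] /andP[v0 vc] /andP[k0 k1] /andP[c0 c1].
move=> /andP[sl su] /andP[tl tu] kc.
have st0 : 0 < s + t by clear - k0 c0 sl tl; lra.
have L1 : 2 * (s + t) <= A * (s + t) by rewrite ler_pM2r.
have L2 : A * (s + t) <= (2 + 1 / 100) * (s + t) by rewrite ler_pM2r.
have N0 : 0 < A * (s + t) + 4 * u by clear - st0 L1 u0; lra.
have t0 : 0 <= t by clear - c0 tl; lra.
have t1 : t <= 1 / (100 * 100) by clear - c0 c1 tu; lra.
have t2 : 0 <= t ^+ 2 <= 1 / (100 * 100).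
  by clear - t0 t1; rewrite sqr_ge0 /= expr2; nra.
have w0 : 0 <= t * (u + v) <= 2 / (100 * 100).
  rewrite mulr_ge0 ?addr_ge0//=.
  have : u + v <= 2 / (100 * 100) by clear - uk k1 vc c1; lra.
  by have := addr_ge0 u0 v0; clear - t0 t1 c1; move: (u + v) => w; nra.
have [N NE] : exists N, N = A * (s + t) + 4 * u by eexists.
rewrite -NE in N0.
have Nn : N != 0 by rewrite gt_eqF.
have N1 : 2 * (s + t) <= N by clear - NE L1 u0; lra.
have N2 : N <= (2 + 1 / 100) * (s + t) + 4 * u by clear - NE L2; lra.
(* With N = A (s + t) + 4 u >= 2 (s + t), the first coefficient is at most about 1 / (2 * 22/100)
   and the second at most about 2. The second stays away from 0 because t, c and k are comparable
   and N is of order k. *)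
exists ((k + c) * (1 - t ^+ 2) / N).
exists ((4 * t + 2 * t * (t * (u + v))) / N).
split.
- apply: (mulIf Nn).
  have -> : forall x z, (x / N * (k - c) - z / N * (u - v)) * N =
      x * (k - c) - z * (u - v).
    by move=> x z; field.
  rewrite NE.
  have -> : (s - t) * (A * (s + t) + 4 * u) =
     (A * s ^+ 2 + 4 * u * s) - (B * t ^+ 2 + 4 * v * t)
     - (A - B) * t ^+ 2 - 4 * (u - v) * t by ring.
  by rewrite Es Et AB; ring.
- have kc0 : 0 <= k + c by clear - k0 c0; lra.
  apply/andP; split.
    by apply: divr_ge0 (ltW N0); apply: mulr_ge0 => //; clear - t2; lra.
  rewrite ler_pdivrMr//.
  have : (k + c) * (1 - t ^+ 2) <= k + c by rewrite ler_piMr//; clear - t2; lra.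
  by clear - N1 sl tl k0 c0; lra.
- rewrite (ler_pdivrMr _ _ N0) (ler_pdivlMr _ _ N0).
  move: (t * (u + v)) w0 => w /andP[w0 w1].
  have tw0 : 0 <= t * w by rewrite mulr_ge0.
  have tw1 : t * w <= 2 / (100 * 100) * t by rewrite mulrC ler_wpM2r.
  by apply/andP; clear - tw0 tw1 N1 N2 sl su tl tu uk kc u0 k0; split; lra.
Qed.

(* The hypotheses place all variables but a, b, x, y at the scale of the box. *)
Lemma expand_estimate a b s t u v k c x y :
    0 <= a <= 23 / 10 -> 12 / 100 <= b <= 201 / 100 ->
    0 <= s <= 1 / (100 * 100) -> 0 <= t <= 1 / (100 * 100) ->
    0 <= u <= 1 / (100 * 100) -> 0 <= v <= 1 / (100 * 100) ->
    0 <= k <= 1 / (100 * 100) -> 0 <= c <= 1 / (100 * 100) -> 50 * `|y| <= `|x| ->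
  let A := x * (1 - s * t + b * (1 - u * v)) - a * (1 - u * v) * y in
  let B := y * (s - s * t * u + c * a) + x * (s * t * k - c * b) in
  [/\ `|A| <= 31 / 10 * `|x|, 106 / 100 * `|x| <= `|A|
    & `|B| <= 8 / (100 * 100) * `|x|].
Proof.
move=> a01 b01 s01 t01 u01 v01 k01 c01 yx A B.
have b01' : 0 <= b <= 201 / 100 by clear - b01; lra.
have st := mulr_itv s01 t01; have uv := mulr_itv u01 v01.
have stu := mulr_itv st u01; have stk := mulr_itv st k01.
have ca := mulr_itv c01 a01; have cb := mulr_itv c01 b01'.
have auv := mulr_itv a01 uv; have buv := mulr_itv b01' uv.
have x0 := normr_ge0 x; have y0 := normr_ge0 y.
have c1 : 111 / 100 <= 1 - s * t + b * (1 - u * v) <= 302 / 100.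
  by rewrite mulrBr mulr1; clear - st buv b01; lra.
have c2 : 0 <= a * (1 - u * v) <= 23 / 10.
  apply/andP; split; last by rewrite mulrBr mulr1; clear - auv a01; lra.
  by apply: mulr_ge0; [clear - a01; lra|clear - uv; lra].
have c3 : `|s - s * t * u + c * a| <= 4 / (100 * 100).
  by rewrite ler_norml; clear - s01 stu ca; lra.
have c4 : `|s * t * k - c * b| <= 3 / (100 * 100).
  by rewrite ler_norml; clear - stk cb; lra.
have Ex : `|x * (1 - s * t + b * (1 - u * v))| = `|x| * (1 - s * t + b * (1 - u * v)).
  by rewrite normrM; congr (_ * _); rewrite ger0_norm//; clear - c1; lra.
have Ey : `|a * (1 - u * v) * y| = a * (1 - u * v) * `|y|.
  by rewrite normrM; congr (_ * _); rewrite ger0_norm//; clear - c2; lra.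
have x1 : 111 / 100 * `|x| <= `|x| * (1 - s * t + b * (1 - u * v)) <= 302 / 100 * `|x|.
  by rewrite !(mulrC `|x|); case/andP: c1 => ? ?; rewrite !ler_wpM2r.
have y1 : a * (1 - u * v) * `|y| <= 23 / 10 * `|y|.
  by case/andP: c2 => _ ?; rewrite ler_wpM2r.
split.
- rewrite /A; apply: le_trans (ler_normB _ _) _; rewrite Ex Ey.
  by clear - x1 y1 yx y0; lra.
- rewrite /A; apply: le_trans (lerB_dist _ _); rewrite Ex Ey.
  by clear - x1 y1 yx y0; lra.
- rewrite /B; apply: le_trans (ler_normD _ _) _; rewrite !normrM.
  have z1 : `|y| * `|s - s * t * u + c * a| <= `|y| * (4 / (100 * 100)) by rewrite ler_wpM2l.
  have z2 : `|x| * `|s * t * k - c * b| <= `|x| * (3 / (100 * 100)) by rewrite ler_wpM2l.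
  by apply: le_trans (lerD z1 z2) _; clear - yx x0 y0; lra.
Qed.

(* The constant 50 is the slope of the vertical cones: outside of them differences
   in h dominate, and the step moves them further away from the cones. *)
Lemma step_expand u v k c : 0 <= u -> 0 <= v -> u <= k -> v <= c ->
    k <= radius -> c <= radius -> 50 * `|k - c| <= `|u - v| ->
  [/\ `|nextu u k - nextu v c| <= 4 * `|u - v|,
      50 * `|nextk u k - nextk v c| <= `|u - v|
    & `|u - v| + 50 * `|nextk u k - nextk v c| <= `|nextu u k - nextu v c|].
Proof.
move=> u0 v0 uk vc kr cr kc; have rE := @radiusE R.
have [uv|uv] := eqVneq u v.
  have /eqP : `|k - c| = 0.
    by apply/eqP; rewrite eq_le normr_ge0 andbT; move: kc; rewrite uv subrr normr0; lra.
  by rewrite normr_eq0 subr_eq0 uv => /eqP ->; rewrite !subrr !normr0; split; lra.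
have x0 : 0 < `|u - v| by rewrite normr_gt0 subr_eq0.
have kc1 := ler_norm (k - c); have kc2 := ler_norm (c - k).
rewrite distrC in kc2.
have [k0 c0] : 0 < k /\ 0 < c.
  clear - u0 v0 uk vc kc x0 kc1 kc2.
  by move: x0 kc; case: (ger0P (u - v)) => ? ? ?; split; lra.
have kr' : `|k| <= radius by rewrite gtr0_norm.
have cr' : `|c| <= radius by rewrite gtr0_norm.
have /andP[d0 d1] := den_bounds u0 (le_trans uk kr) kr'.
have /andP[e0 e1] := den_bounds v0 (le_trans vc cr) cr'.
have sl : 22 / 100 * `|k| <= wshift u k by apply: wshift_lower; rewrite // gtr0_norm.
have tl : 22 / 100 * `|c| <= wshift v c by apply: wshift_lower; rewrite // gtr0_norm.
have su := wshift_upper k u0; have tu := wshift_upper c v0.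
rewrite (gtr0_norm k0) in su sl; rewrite (gtr0_norm c0) in tu tl.
have k1 : k <= 1 / (100 * 100) by clear - kr rE; lra.
have c1 : c <= 1 / (100 * 100) by clear - cr rE; lra.
have [a [b [sE a01 b01]]] : exists a b,
   [/\ wshift u k - wshift v c = a * (k - c) - b * (u - v),
    0 <= a <= 23 / 10 & 12 / 100 <= b <= 201 / 100].
  apply: (@quadratic_diff (D1 u k) (D1 v c)); rewrite ?wshiftP//.
  - rewrite D1_ge2 /= /D1.
    have : u ^+ 2 <= 1 / (10 * 100) by clear - u0 uk k1; rewrite expr2; nra.
    have : k ^+ 2 <= 1 / (10 * 100) by clear - k0 k1; rewrite expr2; nra.
    by clear; move=> ? ?; lra.
  - by rewrite /D1; ring.
  - exact/andP.
  - exact/andP.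
  - exact/andP.
  - exact/andP.
  - exact/andP.
  - exact/andP.
  (* Since |u - v| is at most the larger of k and c, the cone condition makes k and c comparable. *)
  - by move: kc; clear - kc1 u0 v0 uk vc k0 c0; case: (ger0P (u - v)) => ? ?; lra.
rewrite /nextu /nextk.
move: (wshift u k) (wshift v c) sE d0 d1 e0 e1 sl tl su tu => s t sE d0 d1 e0 e1 sl tl su tu.
have su0 : 0 < 1 - s * u by clear - d0; lra.
have tv0 : 0 < 1 - t * v by clear - e0; lra.
have [su1 tv1] : 1 - s * u != 0 /\ 1 - t * v != 0 by rewrite !gt_eqF.
have D0 := mulr_gt0 su0 tv0.
have D01 : 98 / 100 <= (1 - s * u) * (1 - t * v) <= 1.
  apply/andP; split; last by apply: mulr_ile1 => //; exact: ltW.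
  have := @ler_pM R (99 / 100) (1 - s * u) (99 / 100) (1 - t * v).
  by clear - d0 e0; move=> H; have := H _ _ d0 e0; lra.
have -> : (u - s) / (1 - s * u) - (v - t) / (1 - t * v) =
   ((u - v) * (1 - s * t) - (s - t) * (1 - u * v)) / ((1 - s * u) * (1 - t * v)).
  by field; rewrite su1 tv1.
have -> : s * k / (1 - s * u) - t * c / (1 - t * v) =
   ((k - c) * (s - s * t * u) + c * (s - t) + s * t * k * (u - v))
   / ((1 - s * u) * (1 - t * v)).
  by field; rewrite su1 tv1.
rewrite sE !normrM !normfV (gtr0_norm D0).
have -> : (u - v) * (1 - s * t) - (a * (k - c) - b * (u - v)) * (1 - u * v) =
  (u - v) * (1 - s * t + b * (1 - u * v)) - a * (1 - u * v) * (k - c) by ring.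
have -> : (k - c) * (s - s * t * u) + c * (a * (k - c) - b * (u - v)) + s * t * k * (u - v) =
  (k - c) * (s - s * t * u + c * a) + (u - v) * (s * t * k - c * b) by ring.
have [] := @expand_estimate a b s t u v k c (u - v) (k - c) a01 b01.
- by clear - sl su k0 k1; lra.
- by clear - tl tu c0 c1; lra.
- by clear - u0 uk k1; lra.
- by clear - v0 vc c1; lra.
- by clear - k0 k1; lra.
- by clear - c0 c1; lra.
- exact: kc.
move: D0 D01; move: ((1 - s * u) * (1 - t * v)) => D D0 /andP[D1 D2].
move: `|_ - _ * _ * _| `|_ * _ + _ * _| `|u - v| x0 => A B x x0 AU AL BU.
clear - D0 D1 D2 AU AL BU x0.
have xD1 : 98 / 100 * x <= x * D by rewrite mulrC ler_pM2l.
have xD2 : x * D <= x by rewrite ler_piMr// ltW.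
have BD : B / D <= 1 / (10 * 100) * x by rewrite ler_pdivrMr//; lra.
split.
- by rewrite ler_pdivrMr//; lra.
- by lra.
- suff : 105 / 100 * x <= A / D by lra.
  by rewrite ler_pdivlMr//; lra.
Qed.

End PlaneExpansion.

(** * The curves with prescribed signs *)

Section PlaneCurves.
Variable R : realType.
Implicit Types (h u v k c s t : R) (p q : R * R) (sigma tau : sign_seq) (n m : nat).

Lemma lipschitz_within_continuous (A : set R) (f : R -> R) (C : R) :
  (forall x y, A x -> A y -> `|f x - f y| <= C * `|x - y|) ->
  {within A, continuous f}.
Proof.
move=> fC; apply/subspace_continuousP => x Ax; apply/cvgrPdist_lt => e e0.
have C0 : 0 < `|C| + 1 by rewrite ltr_wpDl.
rewrite near_withinE; near=> y => Ay.
apply: le_lt_trans (fC _ _ Ax Ay) _.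
apply: (@le_lt_trans _ _ ((`|C| + 1) * `|x - y|)).
  by rewrite ler_wpM2r// ler_wpDr// ler_norm.
rewrite mulrC -ltr_pdivlMr//; near: y.
by apply: cvgr_dist_lt => //; exact: divr_gt0.
Unshelve. all: by end_near.
Qed.

Lemma nextk_ge0 u k : 0 <= u -> u <= radius -> 0 <= k -> k <= radius ->
  0 <= nextk u k.
Proof.
move=> u0 ur k0 kr; have := @normr_nextk R u k u0 ur.
by rewrite (ger0_norm k0) => /(_ kr) <-.
Qed.

Lemma nextk_half u k : 0 <= u -> u <= radius -> 0 <= k -> k <= radius ->
  nextk u k <= k / 2.
Proof.
move=> u0 ur k0 kr; have kr' : `|k| <= radius by rewrite ger0_norm.
have := nextk_bound u0 ur kr'; have := ler_norm (nextk u k).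
have rE := @radiusE R; have : k ^+ 2 <= 1 / 2 * k.
  by rewrite expr2 ler_wpM2r//; lra.
lra.
Qed.

Lemma step_k_ge0 p : in_box p -> 0 <= p.2 -> 0 <= (step p).2.
Proof.
case: p => h k [/= hr kr] k0; rewrite ger0_norm// in kr.
by apply: nextk_ge0 => //; exact: ltW.
Qed.

Lemma same_sign_dist b u v : `|sg b * u - sg b * v| = `|u - v|.
Proof. by rewrite -mulrBr normrM sg_norm mul1r. Qed.

(** While the signs agree, differences of h are differences of |h|, to which [step_expand] applies.
    Its last bound does two things: it keeps the pair outside the vertical cone and prevents the
    horizontal distance from shrinking. *)
Lemma orbit_expand n p q : in_box p -> in_box q -> 0 <= p.2 -> 0 <= q.2 ->
    trapped p -> trapped q ->
    (forall j, (j < n)%N -> (0 <= (iter j step p).1) = (0 <= (iter j step q).1)) ->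
    50 * `|p.2 - q.2| <= `|p.1 - q.1| ->
  `|p.1 - q.1| <= `|(iter n step p).1 - (iter n step q).1|.
Proof.
elim: n p q => // n IH p q pb qb p0 q0 pt qt sgn pq; rewrite !iterSr.
have [pr1 pr2] := pb; have [qr1 qr2] := qb.
have := pt 0%N; have := qt 0%N; rewrite /= (ger0_norm p0) (ger0_norm q0) => q1 p1.
rewrite (ger0_norm p0) in pr2; rewrite (ger0_norm q0) in qr2.
have s0 := sgn 0%N isT; rewrite /= in s0.
have E : `|p.1 - q.1| = `| `|p.1| - `|q.1| |.
  by rewrite -{1}(sg_abs p.1) -{1}(sg_abs q.1) -s0 same_sign_dist.
have [_ _ ex] := step_expand (normr_ge0 _) (normr_ge0 _) p1 q1 (ltW pr2) (ltW qr2) ltac:(by rewrite -E).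
have ES : `|(step p).1 - (step q).1| = `|nextu `|p.1| p.2 - nextu `|q.1| q.2|.
  by rewrite /step /= -s0 same_sign_dist.
apply: (@le_trans _ _ `|(step p).1 - (step q).1|).
  by rewrite ES E; apply: le_trans ex; rewrite lerDl mulr_ge0.
apply: IH; try exact: step_box; try exact: step_k_ge0; try exact: trapped_step.
  by move=> j jn; rewrite -!iterSr; apply: sgn.
rewrite ES; apply: le_trans ex; rewrite ler_wpDl//.
Qed.

(** Either the pair lies in the vertical cone, or its horizontal distance has not shrunk after n
    steps; but by then trapping bounds it by the two values of |k|, each at most 2^(-2^n). *)
Lemma trapped_sep n p q : in_box p -> in_box q -> trapped p -> trapped q ->
    (forall j, (j < n)%N -> (0 <= (iter j step p).1) = (0 <= (iter j step q).1)) ->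
  `|p.1 - q.1| <= 50 * `| `|p.2| - `|q.2| | + 2 * (1 / 2) ^+ (2 ^ n).
Proof.
move=> pb qb pt qt sgn.
have [pq|pq] := leP `|p.1 - q.1| (50 * `| `|p.2| - `|q.2| |).
  by apply: le_trans pq _; rewrite lerDl mulr_ge0// exprn_ge0//; lra.
apply: ler_wpDl; first by rewrite mulr_ge0.
have fsgn j : (j < n)%N ->
    (0 <= (iter j step (fold p)).1) = (0 <= (iter j step (fold q)).1).
  by move=> jn; rewrite !iter_fold//; exact: sgn.
have := orbit_expand (in_box_fold pb) (in_box_fold qb) (normr_ge0 _) (normr_ge0 _)
  ((trapped_fold pb).2 pt) ((trapped_fold qb).2 qt) fsgn (ltW pq).
rewrite !iter_fold//= => /le_trans; apply.
apply: le_trans (ler_normB _ _) _.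
have := pt n; have := qt n; have := iter_k_bound n pb; have := iter_k_bound n qb.
lra.
Qed.

(* One backward step of the graph transform on the branch [0 <= u]. *)
Lemma pullback_exists (psi : R -> R) k : 0 <= k -> k <= radius ->
    (forall x, 0 <= x -> x <= radius -> `|psi x| <= x) ->
    (forall x y, 0 <= x -> x <= radius -> 0 <= y -> y <= radius ->
       `|psi x - psi y| <= 50 * `|x - y|) ->
  exists u, k / 4 <= u <= k /\ nextu u k = psi (nextk u k).
Proof.
move=> k0 kr psib psil; have rE := @radiusE R.
have kr' : `|k| <= radius by rewrite ger0_norm.
have k4k : k / 4 <= k by lra.
pose f u := nextu u k - psi (nextk u k).
have ub u : k / 4 <= u -> u <= k -> [/\ 0 <= u, u <= radius, 0 <= nextk u k & nextk u k <= radius].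
  move=> u1 u2; have u0 : 0 <= u by lra.
  have ur : u <= radius by lra.
  by split=> //; [exact: nextk_ge0|have := nextk_half u0 ur k0 kr; lra].
have fc : {within `[k / 4, k]%classic, continuous f}.
  (* 4 from [nextu], and 1 from [psi], whose slope 50 meets the factor 1/50 of [nextk]. *)
  apply: (@lipschitz_within_continuous _ _ 5) => x y; rewrite /= !in_itv /=.
  move=> /andP[x1 x2] /andP[y1 y2].
  have [x0 xr X0 Xr] := ub _ x1 x2; have [y0 yr Y0 Yr] := ub _ y1 y2.
  have [e1 e2 _] := step_expand x0 y0 x2 y2 kr kr ltac:(by rewrite subrr normr0 mulr0).
  have -> : f x - f y = (nextu x k - nextu y k) - (psi (nextk x k) - psi (nextk y k)).
    by rewrite /f; ring.
  apply: le_trans (ler_normB _ _) _; have := psil _ _ X0 Xr Y0 Yr.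
  by clear - e1 e2; lra.
have : Num.min (f (k / 4)) (f k) <= 0 <= Num.max (f (k / 4)) (f k).
  rewrite ge_min le_max; apply/andP; split; apply/orP; [left|right].
  (* Left end: the shift, about k / 2, carries k / 4 to about -k / 4, far below the graph, which at
     the new height stays above [- nextk]. *)
  - have [u0 ur U0 Ur] := ub _ (lexx _) k4k.
    have Es := wshiftP k u0; have s0 := wshift_ge0 k u0.
    have s1 := wshift_upper k u0.
    have [d0 d1] := andP (den_bounds u0 ur kr').
    have := psib _ U0 Ur; rewrite ler_norml => /andP[psi1 _].
    rewrite /f subr_le0; apply: le_trans psi1.
    rewrite /nextu /nextk -[leRHS]mulNr.
    have d : 0 < 1 - wshift (k / 4) k * (k / 4) by clear - d0; lra.
    rewrite ler_pM2r ?invr_gt0//.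
    have [k00|kn0] := eqVneq k 0; first by rewrite k00 !mul0r wshift0// subrr mul0r oppr0.
    have kp : 0 < k by rewrite lt_neqAle eq_sym kn0.
    have k1 : k <= 1 / (100 * 100) by clear - kr rE; lra.
    have Al : D1 (k / 4) k <= 2 + 1 / 100.
      have : k ^+ 2 <= 1 / 1000 by clear - kp k1; rewrite expr2; nra.
      by rewrite /D1 exprMn; clear; move: (k ^+ 2) => x; lra.
    have A2 := D1_ge2 (k / 4) k.
    rewrite (ger0_norm k0) in s1.
    move: (wshift _ _) (D1 _ _) Es s0 s1 A2 Al => s A Es s0 s1 A2 Al.
    (* For u = k / 4 the limiting equation is 2 x^2 + x = 1, with root 1/2; 45/100 leaves room for
       the error terms. *)
    suff : 45 / 100 * k <= s by clear - kp k1 s0 s1; nra.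
    clear - Es kp s0 A2 Al; rewrite leNgt; apply/negP => lt.
    have : s ^+ 2 <= (45 / 100 * k) ^+ 2 by rewrite ler_sqr ?nnegrE; lra.
    have : k * s <= 45 / 100 * k ^+ 2 by nra.
    have : 0 < k ^+ 2 by rewrite exprn_gt0.
    have := sqr_ge0 s.
    move: (s ^+ 2) (k ^+ 2) (k * s) => x y z; nra.
  (* Right end: since s is at most 71/100 of k, about 29/100 of k remains, which exceeds [nextk] and
     hence the graph. *)
  - have [u0 ur U0 Ur] := ub _ k4k (lexx _).
    have s0 := wshift_ge0 k u0; have s1 := wshift_upper k u0.
    rewrite (ger0_norm k0) in s1.
    have [d0 d1] := andP (den_bounds u0 ur kr').
    have := psib _ U0 Ur; rewrite ler_norml => /andP[_ psi1].
    rewrite /f subr_ge0; apply: le_trans psi1 _.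
    rewrite /nextu /nextk.
    have d : 0 < 1 - wshift k k * k by clear - d0; lra.
    rewrite ler_pM2r ?invr_gt0//.
    have : wshift k k * k <= 1 / 100 * k by rewrite ler_wpM2r//; clear - s1 kr rE; lra.
    by clear - s1 k0; lra.
move=> /(IVT k4k fc)[u]; rewrite in_itv /= => uk /eqP.
by rewrite subr_eq0 => /eqP ?; exists u.
Qed.

(* The graph transform iterated n times from the zero graph; the graph of
   [approx n sigma] consists of the points with n first signs sigma and h_n = 0. *)
Fixpoint approx n sigma k : R := if n is n'.+1 then
  sg (sigma 0%N) * xget 0 [set u | k / 4 <= u <= k /\
     nextu u k = sg (sigma 0%N) * approx n' (sharp sigma) (nextk u k)]
  else 0.

(** The slope bound 50 reproduces itself. If two pulled-back points violated it, [step_expand] would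
    give their images a horizontal distance exceeding 50 times the vertical one, although the images
    lie on a graph of slope at most 50. *)
Lemma approx_props n sigma :
  [/\ (forall k, 0 <= k -> k <= radius -> `|approx n sigma k| <= k),
      (forall k c, 0 <= k -> k <= radius -> 0 <= c -> c <= radius ->
        `|approx n sigma k - approx n sigma c| <= 50 * `|k - c|)
    & (forall k, 0 <= k -> k <= radius -> exists u,
        [/\ k / 4 <= u <= k, approx n.+1 sigma k = sg (sigma 0%N) * u
          & nextu u k = sg (sigma 0%N) * approx n (sharp sigma) (nextk u k)])].
Proof.
have main m tau : (forall k, 0 <= k -> k <= radius -> `|approx m (sharp tau) k| <= k) ->
   (forall k c, 0 <= k -> k <= radius -> 0 <= c -> c <= radius ->
        `|approx m (sharp tau) k - approx m (sharp tau) c| <= 50 * `|k - c|) ->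
   (forall k, 0 <= k -> k <= radius -> exists u,
        [/\ k / 4 <= u <= k, approx m.+1 tau k = sg (tau 0%N) * u
          & nextu u k = sg (tau 0%N) * approx m (sharp tau) (nextk u k)]).
  move=> b l k k0 kr /=.
  set A := [set u | _]; have exA : exists u, A u.
    apply: (@pullback_exists (fun x => sg (tau 0%N) * approx m (sharp tau) x)) => //.
      by move=> x x0 xr; rewrite normrM sg_norm mul1r; exact: b.
    by move=> x y x0 xr y0 yr; rewrite same_sign_dist; exact: l.
  by have [uk E] := xgetPex 0 exA; exists (xget 0 A).
elim: n sigma => [|n IH] sigma.
  split=> [k k0 kr|k c _ _ _ _|]; first by rewrite normr0.
    by rewrite subrr normr0 mulr_ge0.
  apply: main => [k k0 kr|k c _ _ _ _]; first by rewrite normr0.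
  by rewrite subrr normr0 mulr_ge0.
have step1 tau : (forall k, 0 <= k -> k <= radius -> `|approx n.+1 tau k| <= k) /\
      (forall k c, 0 <= k -> k <= radius -> 0 <= c -> c <= radius ->
        `|approx n.+1 tau k - approx n.+1 tau c| <= 50 * `|k - c|).
  have [_ _ H] := IH tau; have [_ lip _] := IH (sharp tau); split.
    move=> k k0 kr; have [u [/andP[u1 u2] -> _]] := H k k0 kr.
    by rewrite normrM sg_norm mul1r ger0_norm//; lra.
  move=> k c k0 kr c0 cr; have [u [/andP[u1 u2] -> Eu]] := H k k0 kr.
  have [v [/andP[v1 v2] -> Ev]] := H c c0 cr.
  rewrite same_sign_dist leNgt; apply/negP => lt.
  have u0 : 0 <= u by lra.
  have v0 : 0 <= v by lra.
  have [_ _ ex] := step_expand u0 v0 u2 v2 kr cr (ltW lt).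
  have ur : u <= radius by lra.
  have vr : v <= radius by lra.
  have U1 := nextk_half u0 ur k0 kr; have V1 := nextk_half v0 vr c0 cr.
  have := lip (nextk u k) (nextk v c) (nextk_ge0 u0 ur k0 kr) ltac:(lra)
     (nextk_ge0 v0 vr c0 cr) ltac:(lra).
  move: ex; rewrite Eu Ev same_sign_dist.
  by have := normr_ge0 (k - c); clear - lt; lra.
split; [exact: (step1 sigma).1|exact: (step1 sigma).2|].
by apply: main; [exact: (step1 (sharp sigma)).1|exact: (step1 (sharp sigma)).2].
Qed.

(** No strict horizontal expansion is needed: in [step_expand] the terms with factor 50 cancel, and
    the geometric factor 1/2 comes from the weight k, which is at least halved by the step. *)
Lemma approx_cauchy n sigma k : 0 <= k -> k <= radius ->
  `|approx n.+1 sigma k - approx n sigma k| <= k * (1 / 2) ^+ n.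
Proof.
elim: n sigma k => [|n IH] sigma k k0 kr.
  by rewrite expr0 mulr1 subr0; have [b _ _] := approx_props 1 sigma; exact: b.
have [_ _ /(_ k k0 kr)[u [/andP[u1 u2] -> Eu]]] := approx_props n.+1 sigma.
have [_ lip _] := approx_props n.+1 (sharp sigma).
have [_ _ /(_ k k0 kr)[v [/andP[v1 v2] -> Ev]]] := approx_props n sigma.
rewrite same_sign_dist.
have u0 : 0 <= u by lra.
have v0 : 0 <= v by lra.
have [_ _ ex] := step_expand u0 v0 u2 v2 kr kr ltac:(by rewrite subrr normr0 mulr0).
have ur : u <= radius by lra.
have vr : v <= radius by lra.
have U1 := nextk_half u0 ur k0 kr; have V1 := nextk_half v0 vr k0 kr.
have U0 := nextk_ge0 u0 ur k0 kr; have V0 := nextk_ge0 v0 vr k0 kr.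
have Ur : nextk u k <= radius by lra.
have Vr : nextk v k <= radius by lra.
have := lip _ _ U0 Ur V0 Vr; have := IH (sharp sigma) _ V0 Vr.
move: ex; rewrite Eu Ev same_sign_dist.
have := ler_distD (approx n.+1 (sharp sigma) (nextk v k))
  (approx n.+1 (sharp sigma) (nextk u k)) (approx n (sharp sigma) (nextk v k)).
have : nextk v k * (1 / 2) ^+ n <= k * (1 / 2) ^+ n.+1.
  rewrite exprS mulrA ler_wpM2r ?exprn_ge0//; lra.
lra.
Qed.

Lemma half_exprS n : (1 / 2 : R) ^+ n.+1 <= (1 / 2) ^+ n.
Proof. by apply: ler_wiXn2l; [lra|lra|exact: leqnSn]. Qed.

Definition curve sigma k : R := limn (fun n => approx n sigma k).

Lemma curve_approx n sigma k : 0 <= k -> k <= radius ->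
  `|approx n sigma k - curve sigma k| <= 2 * k * (1 / 2) ^+ n.
Proof.
move=> k0 kr.
have [l [xl H]] := @drift_cvg R (fun n => approx n sigma k) (fun n => 2 * k * (1 / 2) ^+ n)
  ltac:(move=> j; apply: le_trans (approx_cauchy j sigma k0 kr) _; rewrite exprS; lra)
  ltac:(move=> j; rewrite mulr_ge0 ?mulr_ge0 ?exprn_ge0//; lra).
by rewrite /curve (cvg_lim _ xl)//; apply: H; exact: half_cvg0.
Qed.

Lemma small_ge0 (x C : R) : (forall n, - (C * (1 / 2) ^+ n) <= x) -> 0 <= x.
Proof.
move=> xC; have H : (- (C * (1 / 2) ^+ n) : R) @[n --> \oo] --> (0 : R).
  by rewrite -[X in _ --> X]oppr0; apply: cvgN; exact: half_cvg0.
rewrite -(cvg_lim _ H)//; apply: limr_le; first by apply/cvg_ex; exists 0.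
by apply: nearW.
Qed.

Lemma small_eq0 (x C : R) : (forall n, `|x| <= C * (1 / 2) ^+ n) -> x = 0.
Proof.
move=> xC; apply/eqP; rewrite eq_le -[x <= 0]oppr_ge0; apply/andP; split.
  by apply: (@small_ge0 _ C) => n; rewrite lerN2; exact: le_trans (ler_norm _) (xC n).
by apply: (@small_ge0 _ C) => n; rewrite lerNl; apply: le_trans (xC n); rewrite -normrN ler_norm.
Qed.

(** The equations satisfied by [approx] pass to the limit, although the preimage varies with n,
    because [nextu] and [nextk] are Lipschitz in u on the cone. *)
Lemma curve_step sigma k : 0 <= k -> k <= radius -> exists u,
  [/\ k / 4 <= u <= k, curve sigma k = sg (sigma 0%N) * u
    & nextu u k = sg (sigma 0%N) * curve (sharp sigma) (nextk u k)].
Proof.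
move=> k0 kr; set e := sg (sigma 0%N).
have ee : e * e = 1 by exact: sg_sq.
pose u := e * curve sigma k.
have E3 : curve sigma k = e * u by rewrite /u mulrA ee mul1r.
have H n : exists v, [/\ k / 4 <= v <= k, `|v - u| <= 2 * k * (1 / 2) ^+ n
    & nextu v k = e * approx n (sharp sigma) (nextk v k)].
  have [_ _ /(_ k k0 kr)[v [v1 E1 E2]]] := approx_props n sigma.
  exists v; split=> //; have := curve_approx n.+1 sigma k0 kr.
  rewrite E1 E3 same_sign_dist => /le_trans; apply.
  by apply: ler_wpM2l; [rewrite mulr_ge0|exact: half_exprS].
have uP : k / 4 <= u <= k.
  apply/andP; split; rewrite -subr_ge0; apply: (@small_ge0 _ (2 * k)) => n;
    by have [v [v1 + _]] := H n; rewrite ler_norml; lra.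
have [u1 u2] := andP uP; have u0 : 0 <= u by lra.
have ur : u <= radius by lra.
have U0 := nextk_ge0 u0 ur k0 kr; have U1 := nextk_half u0 ur k0 kr.
have Ur : nextk u k <= radius by lra.
exists u; split=> //.
(* In units of [2 * k * (1 / 2) ^+ n], 6 is the sum of 4 from [nextu], 1 from moving the argument of
   [approx], and 1 from replacing [approx] by [curve]. *)
apply/eqP; rewrite -subr_eq0; apply/eqP; apply: (@small_eq0 _ (2 * k * 6)) => n.
have [v [/andP[v1 v2] vu Ev]] := H n.
have v0 : 0 <= v by lra.
have vr : v <= radius by lra.
have V0 := nextk_ge0 v0 vr k0 kr; have V1 := nextk_half v0 vr k0 kr.
have Vr : nextk v k <= radius by lra.
have [e1 e2 _] := step_expand v0 u0 v2 u2 kr kr ltac:(by rewrite subrr normr0 mulr0).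
have [_ lip _] := approx_props n (sharp sigma).
have l1 := lip _ _ V0 Vr U0 Ur.
have l2 := curve_approx n (sharp sigma) U0 Ur.
have l3 : 2 * nextk u k * (1 / 2) ^+ n <= 2 * k * (1 / 2) ^+ n.
  by rewrite ler_wpM2r ?exprn_ge0//; lra.
have -> : nextu u k - e * curve (sharp sigma) (nextk u k) =
   - (nextu v k - nextu u k) + e * (approx n (sharp sigma) (nextk v k) -
      approx n (sharp sigma) (nextk u k)) +
      e * (approx n (sharp sigma) (nextk u k) - curve (sharp sigma) (nextk u k)).
  by rewrite Ev; ring.
have en (x : R) : `|e * x| = `|x| by rewrite normrM sg_norm mul1r.
apply: le_trans (ler_normD _ _) _; rewrite en.
apply: le_trans (lerD (ler_normD _ _) l2) _; rewrite en normrN.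
have -> : 2 * k * 6 * (1 / 2) ^+ n = 6 * (2 * k * (1 / 2) ^+ n) by ring.
by clear - e1 e2 l1 l3 vu; lra.
Qed.

Lemma curve0 sigma : curve sigma 0 = 0.
Proof.
have [u [/andP[u1 u2] -> _]] := curve_step sigma (lexx 0) (radius_ge0 R).
by have -> : u = 0 by [apply/eqP; rewrite eq_le u2/=; move: u1; rewrite mul0r]; rewrite mulr0.
Qed.

Lemma curve_abs sigma k : 0 <= k -> k <= radius -> `|curve sigma k| <= k.
Proof.
move=> k0 kr; have [u [/andP[u1 u2] -> _]] := curve_step sigma k0 kr.
by rewrite normrM sg_norm mul1r ger0_norm//; lra.
Qed.

(** This is the purpose of the lower bound [k / 4]: it survives the limit and keeps the curve off h
    = 0, where Wilkinson's choice switches. *)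
Lemma curve_sign sigma k : 0 < k -> k <= radius -> (0 <= curve sigma k) = sigma 0%N.
Proof.
move=> k0 kr; have [u [/andP[u1 u2] -> _]] := curve_step sigma (ltW k0) kr.
rewrite /sg; case: (sigma 0%N); first by rewrite mul1r; lra.
by apply/negbTE; rewrite -ltNge; lra.
Qed.

Lemma curve_box sigma k : 0 <= k -> k < radius -> in_box (curve sigma k, k).
Proof.
move=> k0 kr; split => /=; last by rewrite ger0_norm.
exact: le_lt_trans (curve_abs _ k0 (ltW kr)) kr.
Qed.

Lemma step_curve sigma k : 0 < k -> k < radius ->
  step (curve sigma k, k) =
  (curve (sharp sigma) (step (curve sigma k, k)).2, (step (curve sigma k, k)).2).
Proof.
move=> k0 kr; rewrite {1}/step /= curve_sign ?ltW//.
have [u [/andP[u1 u2] -> Eu]] := curve_step sigma (ltW k0) (ltW kr).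
by rewrite normrM sg_norm mul1r ger0_norm ?Eu ?mulrA ?sg_sq ?mul1r//; lra.
Qed.

Lemma step_k_eq0 p : in_box p -> ((step p).2 == 0) = (p.2 == 0).
Proof.
case: p => h k [/= hr kr]; have [d0 d1] := andP (den_bounds (normr_ge0 h) (ltW hr) (ltW kr)).
have d : 1 - wshift `|h| k * `|h| != 0 by rewrite gt_eqF//; lra.
rewrite /nextk (mulf_eq0 (_ * _)) invr_eq0 (negbTE d) orbF.
by rewrite (mulf_eq0 (wshift _ _)) wshift_eq0// orbb.
Qed.

Definition shiftn n sigma : sign_seq := iter n sharp sigma.

Lemma shiftnE n sigma j : shiftn n sigma j = sigma (n + j)%N.
Proof. by elim: n j => //= n IH j; rewrite /sharp IH addnS. Qed.

Lemma iter_curve n sigma k : 0 < k -> k < radius ->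
  exists2 c, 0 < c < radius & iter n step (curve sigma k, k) = (curve (shiftn n sigma) c, c).
Proof.
move=> k0 kr; elim: n => [|n [c /andP[c0 cr] E]]; first by exists k; rewrite ?k0.
rewrite iterS E step_curve//; have cb := curve_box (shiftn n sigma) (ltW c0) cr.
have := step_box cb; case=> _ /= c1; have := step_k_ge0 cb (ltW c0).
have := step_k_eq0 cb; rewrite /= (gt_eqF c0) => /negbT c2 c3.
exists (step (curve (shiftn n sigma) c, c)).2 => //=.
by rewrite lt_neqAle eq_sym c2 c3 /=; apply: le_lt_trans (ler_norm _) c1.
Qed.

Lemma iter_curve_sign n sigma k : 0 < k -> k < radius ->
  (0 <= (iter n step (curve sigma k, k)).1) = sigma n.
Proof.
move=> k0 kr; have [c /andP[c0 cr] ->] := iter_curve n sigma k0 kr.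
by rewrite /= curve_sign ?ltW// shiftnE addn0.
Qed.

Lemma curve_trapped sigma k : 0 < k -> k < radius -> trapped (curve sigma k, k).
Proof.
move=> k0 kr n; have [c /andP[c0 cr] ->] := iter_curve n sigma k0 kr.
by rewrite /= (ger0_norm (ltW c0)) curve_abs ?ltW.
Qed.

Lemma half_pow_small (x y : R) : (forall n, x <= y + 2 * (1 / 2) ^+ (2 ^ n)) -> x <= y.
Proof.
move=> H; rewrite -subr_ge0; apply: (@small_ge0 _ 2) => n.
by have := H n; have := half_expn_le R n; lra.
Qed.

(** The point and the curve point above the same |k| have all signs in common, so [trapped_sep]
    applies for every n and leaves no gap. *)
Lemma trapped_curve p : in_box p -> trapped p -> p.2 != 0 ->
  p.1 = curve (fun n => 0 <= (iter n step p).1) `|p.2|.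
Proof.
move=> pb pt p2; set sigma := fun n => _.
have k0 : 0 < `|p.2| by rewrite normr_gt0.
have kr : `|p.2| < radius by case: pb.
have cb := curve_box sigma (ltW k0) kr.
apply/eqP; rewrite -subr_eq0 -normr_le0; apply: half_pow_small => n.
have := @trapped_sep n p (curve sigma `|p.2|, `|p.2|) pb cb pt (curve_trapped sigma k0 kr).
by rewrite /= normr_id subrr normr0 mulr0; apply=> j _; rewrite iter_curve_sign.
Qed.

(** The case n -> oo of [trapped_sep]. Height 0 is treated apart, since the signs along the orbit
    are those of sigma only for positive height. *)
Lemma curve_lipschitz sigma k c : 0 <= k -> k < radius -> 0 <= c -> c < radius ->
  `|curve sigma k - curve sigma c| <= 50 * `|k - c|.
Proof.
move=> k0 kr c0 cr.
have [->|kn] := eqVneq k 0.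
  rewrite curve0 !sub0r !normrN (ger0_norm c0).
  by have := curve_abs sigma c0 (ltW cr); lra.
have [->|cn] := eqVneq c 0.
  rewrite curve0 !subr0 (ger0_norm k0).
  by have := curve_abs sigma k0 (ltW kr); lra.
have kp : 0 < k by rewrite lt_neqAle eq_sym kn.
have cp : 0 < c by rewrite lt_neqAle eq_sym cn.
apply: half_pow_small => n.
have := @trapped_sep n _ _ (curve_box sigma k0 kr) (curve_box sigma c0 cr)
  (curve_trapped sigma kp kr) (curve_trapped sigma cp cr).
by rewrite /= (ger0_norm k0) (ger0_norm c0); apply=> j _; rewrite !iter_curve_sign.
Qed.

End PlaneCurves.

(** * Rates of convergence *)

Section PlaneRates.
Variable R : realType.
Implicit Types (h u v k c s t l : R) (p q : R * R) (n m : nat).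

Lemma step_kE p : in_box p -> exists2 d, 99 / 100 <= d <= 1 &
  `|(step p).2| = wshift `|p.1| p.2 * `|p.2| / d.
Proof.
case: p => h k [/= hr kr]; have dd := den_bounds (normr_ge0 h) (ltW hr) (ltW kr).
exists (1 - wshift `|h| k * `|h|) => //; have [d0 d1] := andP dd.
have d : 0 < 1 - wshift `|h| k * `|h| by lra.
by rewrite normrM normfV normrM (gtr0_norm d) (ger0_norm (wshift_ge0 _ _)).
Qed.

(** The quadratic equation reads k^2 = (D1 s + 4 u) s, and the bracket is at most 1 in the box;
    hence s >= k^2. *)
Lemma step_k_lower_cubic p : in_box p -> `|p.2| ^+ 3 <= `|(step p).2|.
Proof.
move=> pb; have [d /andP[d0 d1] ->] := step_kE pb; case: pb => hr kr.
rewrite ler_pdivlMr; last by lra.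
have h0 := normr_ge0 p.1; have k0 := normr_ge0 p.2.
have Es := wshiftP p.2 h0; have s0 := wshift_ge0 p.2 h0.
have s1 := wshift_upper p.2 h0; have rE := @radiusE R.
rewrite -[p.2 ^+ 2 in RHS]real_normK ?num_real// in Es.
have A3 : D1 `|p.1| p.2 <= 3.
  rewrite /D1 -[p.2 ^+ 2]real_normK ?num_real//; clear - h0 k0 hr kr rE.
  have : `|p.1| <= 1 / 100 by lra.
  by have : `|p.2| <= 1 / 100 by [lra]; rewrite !expr2; nra.
have A2 := D1_ge2 `|p.1| p.2.
move: `|p.1| `|p.2| (D1 _ _) (wshift _ _) Es s0 s1 A2 A3 h0 k0 hr kr => u k A s.
move=> Es s0 s1 A2 A3 u0 k0 ur kr.
have : k ^+ 2 <= s.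
  have e : A * s + 4 * u <= 1.
    have : A * s <= 3 * s by rewrite ler_wpM2r.
    by clear - s1 ur kr rE; lra.
  have -> : k ^+ 2 = (A * s + 4 * u) * s by rewrite -Es; ring.
  by rewrite ler_piMl.
move=> ks; apply: (@le_trans _ _ (k ^+ 3)); last first.
  by rewrite exprSr ler_wpM2r.
by rewrite ler_piMr// exprn_ge0.
Qed.

Lemma step_k_lower_quadratic p : in_box p -> `|p.1| <= `|p.2| ->
  22 / 100 * `|p.2| ^+ 2 <= `|(step p).2|.
Proof.
move=> pb hk; have [d /andP[d0 d1] ->] := step_kE pb; case: pb => hr kr.
have d2 : 0 < d by lra.
rewrite ler_pdivlMr//.
have s1 := wshift_lower (normr_ge0 _) hk (ltW kr).
have k0 := normr_ge0 p.2.
apply: (@le_trans _ _ (22 / 100 * `|p.2| ^+ 2)).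
  by rewrite ler_piMr// mulr_ge0 ?exprn_ge0//; lra.
by rewrite expr2 mulrA ler_wpM2r.
Qed.

(** The constant must serve from the first step on, before h is near its limit l. If |k| <= |l| / 2,
    then |h| >= |l| / 2 and the term [4 * u * s] bounds s by a multiple of k^2 / |l|; otherwise |l|
    < 2 |k| and s <= 71/100 |k| is enough. *)
Lemma step_k_upper_cubic p l : in_box p -> l != 0 -> `|p.1 - l| <= `|p.2| ->
  `|(step p).2| <= 4 / `|l| * `|p.2| ^+ 3.
Proof.
move=> pb l0 hl; have [d /andP[d0 d1] ->] := step_kE pb; case: pb => hr kr.
have d2 : 0 < d by lra.
rewrite ler_pdivrMr//.
have h0 := normr_ge0 p.1; have k0 := normr_ge0 p.2.
have Es := wshiftP p.2 h0; have s0 := wshift_ge0 p.2 h0.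
have s1 := wshift_upper p.2 h0; have A0 := D1_gt0 `|p.1| p.2.
have lh : `|l| - `|p.1| <= `|p.2|.
  by apply: le_trans hl; rewrite distrC; exact: lerB_dist.
rewrite -[p.2 ^+ 2 in RHS]real_normK ?num_real// in Es.
have {}l0 : 0 < `|l| by rewrite normr_gt0.
move: `|p.1| `|p.2| `|l| (D1 _ _) (wshift _ _) l0 Es s0 s1 A0 h0 k0 lh {hl hr kr} => u k {}l A s.
move=> l0 Es s0 s1 A0 u0 k0 lh.
have sl : s * l <= 2 * k ^+ 2.
  have As : 0 <= A * s ^+ 2 by rewrite mulr_ge0 ?sqr_ge0 ?ltW.
  have [kl|kl] := leP k (l / 2).
    have : l * s <= 2 * u * s by rewrite ler_wpM2r//; lra.
    have : 0 <= k ^+ 2 by exact: sqr_ge0.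
    by clear - Es As; lra.
  have : s * l <= s * (2 * k) by rewrite ler_wpM2l//; lra.
  have : s * k <= 71 / 100 * k * k by rewrite ler_wpM2r.
  have : 0 <= k * k by rewrite mulr_ge0.
  by rewrite expr2; lra.
have : s <= 2 / l * k ^+ 2 by rewrite mulrAC ler_pdivlMr.
move=> sk; apply: (@le_trans _ _ (2 / l * k ^+ 3)).
  by rewrite exprSr mulrA ler_wpM2r.
have : 0 <= k ^+ 3 / l by rewrite divr_ge0 ?exprn_ge0// ltW.
move=> x0; have -> : 2 / l * k ^+ 3 = 2 * (k ^+ 3 / l) by rewrite mulrAC -mulrA.
have -> : 4 / l * k ^+ 3 * d = 4 * d * (k ^+ 3 / l) by field; rewrite gt_eqF.
by rewrite ler_wpM2r//; lra.
Qed.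

End PlaneRates.

(** * The parametrization and the QR step *)

Section Mat3.
Variable R : realType.
Implicit Types (h k s a b : R) (T Q W : 'M[R]_3).

Definition mat3 (l : seq (seq R)) : 'M[R]_3 :=
  \matrix_(i < 3, j < 3) nth 0 (nth [::] l i) j.

Lemma ord3P (P : 'I_3 -> Prop) : P 0 -> P 1 -> P 2 -> forall i, P i.
Proof.
move=> P0 P1 P2 [[|[|[|//]]] i3].
- by rewrite (_ : Ordinal i3 = 0)//; apply: val_inj.
- by rewrite (_ : Ordinal i3 = 1)//; apply: val_inj.
- by rewrite (_ : Ordinal i3 = 2)//; apply: val_inj.
Qed.

Lemma sum3E (F : 'I_3 -> R) : \sum_i F i = F 0 + F 1 + F 2.
Proof.
rewrite !big_ord_recl big_ord0 addr0 addrA.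
by congr (_ + F _ + F _); apply: val_inj.
Qed.

(* [D1] and [D2] are the squared norms of the vectors (1 + h, 1 - h, k) and
   (k (1 - h), k (1 + h), -2 (1 - h^2)), which are proportional to the first and
   last components of the unit eigenvectors. *)
Definition D2 h k : R := 4 * (1 - h ^+ 2) ^+ 2 + k ^+ 2 * (2 + 2 * h ^+ 2).
Definition sqrtD1 h k : R := Num.sqrt (D1 h k).
Definition sqrtD2 h k : R := Num.sqrt (D2 h k).

(** The last column of [eigV] is proportional to the cross product of v and Lambda v, for v = (1 +
    h, 1 - h, k) along the first column; this is why the (0, 2) entry vanishes. The middle diagonal
    entry comes from the zero trace. *)
Definition Tm h k : 'M[R]_3 :=
  let a1 := 4 * h / D1 h k in
  let a3 := - (4 * h * k ^+ 2) / D2 h k in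
  let b1 := sqrtD2 h k / D1 h k in
  let b2 := 2 * (1 - h ^+ 2) * k * sqrtD1 h k / D2 h k in
  mat3 [:: [:: a1; b1; 0]; [:: b1; - a1 - a3; b2]; [:: 0; b2; a3]].

(* The rows are the unit eigenvectors of [Tm h k], for the eigenvalues 1, -1, 0. *)
Definition eigV h k : 'M[R]_3 :=
  let r1 := (sqrtD1 h k)^-1 in let r2 := (sqrtD2 h k)^-1 in
  mat3 [::
   [:: (1 + h) * r1; (1 + h) * (2 * (1 - h) ^+ 2 + k ^+ 2) * r1 * r2; k * (1 - h) * r2];
   [:: (1 - h) * r1; - ((1 - h) * (2 * (1 + h) ^+ 2 + k ^+ 2)) * r1 * r2; k * (1 + h) * r2];
   [:: k * r1; - (4 * h * k) * r1 * r2; - (2 * (1 - h ^+ 2)) * r2]].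

Lemma D2_gt0 h k : `|h| < 1 -> 0 < D2 h k.
Proof.
move=> h1; rewrite /D2; apply: ltr_wpDr.
  by rewrite mulr_ge0 ?sqr_ge0//; have := sqr_ge0 h; lra.
rewrite mulr_gt0// exprn_gt0// subr_gt0 -real_normK ?num_real//.
by rewrite exprn_ilt1.
Qed.

Lemma sqrtD1_gt0 h k : 0 < sqrtD1 h k.
Proof. by rewrite sqrtr_gt0 D1_gt0. Qed.

Lemma sqrtD2_gt0 h k : `|h| < 1 -> 0 < sqrtD2 h k.
Proof. by move=> h1; rewrite sqrtr_gt0 D2_gt0. Qed.

Lemma sqrtD1_sq h k : sqrtD1 h k ^+ 2 = D1 h k.
Proof. by rewrite sqr_sqrtr// ltW ?D1_gt0. Qed.

Lemma sqrtD2_sq h k : `|h| < 1 -> sqrtD2 h k ^+ 2 = D2 h k.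
Proof. by move=> h1; rewrite sqr_sqrtr// ltW ?D2_gt0. Qed.

Lemma eigV_orth h k : `|h| < 1 -> (eigV h k)^T *m eigV h k = 1%:M.
Proof.
move=> h1; have E1 := sqrtD1_sq h k; have E2 := sqrtD2_sq k h1.
have n1 : sqrtD1 h k != 0 by rewrite gt_eqF ?sqrtD1_gt0.
have n2 : sqrtD2 h k != 0 by rewrite gt_eqF ?sqrtD2_gt0.
apply/matrixP => i j; rewrite !mxE sum3E !mxE.
move: (sqrtD1 h k) (sqrtD2 h k) E1 E2 n1 n2 => r t; rewrite /D1 /D2 => E1 E2 n1 n2.
elim/ord3P: i; elim/ord3P: j => /=; rewrite ?mulr1n ?mulr0n; by field: E1 E2; rewrite ?n1 ?n2.
Qed.

Lemma eigV_orthr h k : `|h| < 1 -> eigV h k *m (eigV h k)^T = 1%:M.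
Proof. by move=> h1; apply: mulmx1C; exact: eigV_orth. Qed.

Lemma diag3E (a b c : R) :
  diag_mx (\row_(j < 3) [:: a; b; c]`_j) = mat3 [:: [:: a; 0; 0]; [:: 0; b; 0]; [:: 0; 0; c]].
Proof.
apply/matrixP => i j; rewrite !mxE.
by elim/ord3P: i; elim/ord3P: j => /=; rewrite ?mulr1n ?mulr0n.
Qed.

Lemma LambdaE : Lambda R = mat3 [:: [:: 1; 0; 0]; [:: 0; -1; 0]; [:: 0; 0; 0]].
Proof. exact: diag3E. Qed.

Lemma Tm_spectral h k : `|h| < 1 -> Tm h k = (eigV h k)^T *m Lambda R *m eigV h k.
Proof.
move=> h1; have E1 := sqrtD1_sq h k; have E2 := sqrtD2_sq k h1.
have n1 : sqrtD1 h k != 0 by rewrite gt_eqF ?sqrtD1_gt0.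
have n2 : sqrtD2 h k != 0 by rewrite gt_eqF ?sqrtD2_gt0.
rewrite LambdaE; apply/matrixP => i j; rewrite !mxE sum3E !mxE !sum3E !mxE -E1 -E2.
move: (sqrtD1 h k) (sqrtD2 h k) E1 E2 n1 n2 => r t; rewrite /D1 /D2 => E1 E2 n1 n2.
by elim/ord3P: i; elim/ord3P: j => /=; field: E1 E2; rewrite ?n1 ?n2.
Qed.

(** The transition matrix [W] between the two orthogonal factors is orthogonal and upper triangular
    with positive diagonal, hence the identity. *)
Lemma qr_unique A Q U Q' U' : is_QR A Q U -> is_QR A Q' U' -> Q = Q' :> 'M[R]_3.
Proof.
move=> [AE Qo Ut Ud] [AE' Qo' Ut' Ud'].
pose W := Q'^T *m Q.
have WU : W *m U = U' by rewrite -mulmxA -AE AE' mulmxA Qo' mul1mx.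
have WW : W^T *m W = 1%:M.
  by rewrite trmx_mul trmxK mulmxA -(mulmxA _ Q') (mulmx1C Qo') mulmx1.
have QW : Q = Q' *m W by rewrite mulmxA (mulmx1C Qo') mul1mx.
rewrite QW; suff -> : W = 1%:M by rewrite mulmx1.
move: W WU WW {QW} => W WU WW.
have e i j : U' i j = W i 0 * U 0 j + W i 1 * U 1 j + W i 2 * U 2 j.
  by rewrite -WU mxE sum3E.
have f i j : W 0 i * W 0 j + W 1 i * W 1 j + W 2 i * W 2 j = (i == j)%:R.
  by have /matrixP/(_ i j) := WW; rewrite !mxE sum3E !mxE.
have u10 : U 1 0 = 0 by exact: Ut.
have u20 : U 2 0 = 0 by exact: Ut.
have u21 : U 2 1 = 0 by exact: Ut.
have v10 : U' 1 0 = 0 by exact: Ut'.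
have v20 : U' 2 0 = 0 by exact: Ut'.
have v21 : U' 2 1 = 0 by exact: Ut'.
have p0 := Ud 0; have p1 := Ud 1; have p2 := Ud 2.
have p0' := Ud' 0; have p1' := Ud' 1; have p2' := Ud' 2.
have zero x y : 0 < y -> x * y = 0 -> x = 0 :> R.
  by move=> y0 /eqP; rewrite mulf_eq0 (gt_eqF y0) orbF => /eqP.
have w10 : W 1 0 = 0 by apply: (zero _ (U 0 0)) => //; rewrite -v10 e u10 u20; ring.
have w20 : W 2 0 = 0 by apply: (zero _ (U 0 0)) => //; rewrite -v20 e u10 u20; ring.
have w21 : W 2 1 = 0 by apply: (zero _ (U 1 1)) => //; rewrite -v21 e w20 u21; ring.
have one x : 0 < x -> x * x = 1 -> x = 1 :> R.
  by move=> x0 /eqP; rewrite -expr2 sqrf_eq1 => /orP[/eqP//|/eqP xE]; move: x0; rewrite xE; lra.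
have w00 : W 0 0 = 1.
  apply: one; last by rewrite -[RHS](f 0 0) w10 w20; ring.
  by rewrite -(pmulr_lgt0 _ p0); move: p0'; rewrite e u10 u20 !mulr0 !addr0.
have w01 : W 0 1 = 0 by rewrite -[RHS](f 0 1) w10 w20 w00; ring.
have w02 : W 0 2 = 0 by rewrite -[RHS](f 0 2) w10 w20 w00; ring.
have w11 : W 1 1 = 1.
  apply: one; last by rewrite -[RHS](f 1 1) w01 w21; ring.
  by rewrite -(pmulr_lgt0 _ p1); move: p1'; rewrite e w10 u21 mul0r mulr0 add0r addr0.
have w12 : W 1 2 = 0 by rewrite -[RHS](f 1 2) w01 w21 w11; ring.
have w22 : W 2 2 = 1.
  apply: one; last by rewrite -[RHS](f 2 2) w02 w12; ring.
  by rewrite -(pmulr_lgt0 _ p2); move: p2'; rewrite e w20 w21 !mul0r !add0r.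
apply/matrixP => i j; rewrite mxE.
by elim/ord3P: i; elim/ord3P: j => //=; rewrite ?mulr1n ?mulr0n.
Qed.

Lemma conj_chain (V W J L : 'M[R]_3) : W^T *m W = 1%:M -> V *m V^T = 1%:M ->
  J *m J = 1%:M -> J *m L = L *m J -> J^T = J ->
  (V^T *m J *m W)^T *m (V^T *m L *m V) *m (V^T *m J *m W) = W^T *m L *m W.
Proof.
move=> Wo Vo J2 JL Jt; rewrite !trmx_mul trmxK Jt.
rewrite !mulmxA -(mulmxA _ V V^T) Vo mulmx1 -(mulmxA _ V V^T) Vo mulmx1.
by rewrite -(mulmxA W^T J L) JL mulmxA -(mulmxA (W^T *m L) J J) J2 mulmx1.
Qed.

(* With [Q = V^T * sgnJ s * V'] and [U = V'^T * absE s * V] one gets a QR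
   decomposition of [V^T * (Lambda - s) * V]. *)
Definition absE s := mat3 [:: [:: 1 - s; 0; 0]; [:: 0; 1 + s; 0]; [:: 0; 0; `|s|]].
Definition sgnJ s := mat3 [:: [:: 1; 0; 0]; [:: 0; -1; 0]; [:: 0; 0; - Num.sg s]].
Definition shifth s h := (h - s) / (1 - s * h).
Definition shiftk s h k := `|s| * k / (1 - s * h).

Lemma shift_den s h : `|h| <= 1 / 10 -> `|s| <= 1 / 10 ->
  9 / 10 <= 1 - s * h <= 11 / 10.
Proof.
move=> hs ss; have : `|s * h| <= 1 / 10 * (1 / 10) by rewrite normrM ler_pM.
by clear; rewrite ler_norml; lra.
Qed.

Lemma shifth_small s h : `|h| <= 1 / 10 -> `|s| <= 1 / 10 -> `|shifth s h| <= 1 / 4.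
Proof.
move=> hs ss; have [d0 d1] := andP (shift_den hs ss).
have d : 0 < 1 - s * h by clear - d0; lra.
rewrite normrM normfV (gtr0_norm d) ler_pdivrMr//.
apply: le_trans (ler_normB _ _) _.
by clear - d0 hs ss; lra.
Qed.

Lemma sgnJ_sq s : s != 0 -> sgnJ s *m sgnJ s = 1%:M.
Proof.
move=> s0; apply/matrixP => i j; rewrite !mxE sum3E !mxE.
elim/ord3P: i; elim/ord3P: j => /=; rewrite ?mulr1n ?mulr0n; try ring.
by rewrite !mul0r !add0r mulrNN -expr2 sqr_sg s0.
Qed.

Lemma sgnJ_Lambda s : sgnJ s *m Lambda R = Lambda R *m sgnJ s.
Proof.
rewrite LambdaE; apply/matrixP => i j; rewrite !mxE !sum3E !mxE.
by elim/ord3P: i; elim/ord3P: j => /=; ring.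
Qed.

Lemma tr_sgnJ s : (sgnJ s)^T = sgnJ s.
Proof.
by apply/matrixP => i j; rewrite !mxE; elim/ord3P: i; elim/ord3P: j.
Qed.

Lemma sgnJ_absE s : sgnJ s *m absE s = Lambda R - s%:M.
Proof.
rewrite LambdaE; apply/matrixP => i j; rewrite !mxE !sum3E !mxE.
elim/ord3P: i; elim/ord3P: j => /=; rewrite ?mulr1n ?mulr0n; try ring.
by rewrite [s in RHS]numEsg; ring.
Qed.

(** [absE s] maps (1 + h, 1 - h, k) to ((1 - s) (1 + h), (1 + s) (1 - h), |s| k), which is 1 - s h
    times (1 + h', 1 - h', k'): this is the origin of [shifth] and [shiftk], and it clears the first
    column of the triangular factor below the diagonal. *)
Lemma eigV_QR s h k : `|h| <= 1 / 10 -> `|k| <= 1 / 10 -> `|s| <= 1 / 10 -> s != 0 ->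
  is_QR (Tm h k - s%:M)
  ((eigV h k)^T *m sgnJ s *m eigV (shifth s h) (shiftk s h k))
  ((eigV (shifth s h) (shiftk s h k))^T *m absE s *m eigV h k).
Proof.
move=> hs ks ss s0; have h'_small := shifth_small hs ss; have den := shift_den hs ss.
have h1 : `|h| < 1 by clear - hs; lra.
have h'1 : `|shifth s h| < 1 by clear - h'_small; lra.
set h' := shifth s h in h'_small h'1 *; set k' := shiftk s h k.
have Vo := eigV_orth k h1; have Wo := eigV_orth k' h'1.
have Vo' := eigV_orthr k h1; have Wo' := eigV_orthr k' h'1.
have [d0 d1] := andP den; have d : 0 < 1 - s * h by lra.
have dn : 1 - s * h != 0 by rewrite gt_eqF.
have q1h : (sqrtD1 h k)^-1 > 0 by rewrite invr_gt0 sqrtD1_gt0.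
have q2h : (sqrtD2 h k)^-1 > 0 by rewrite invr_gt0 sqrtD2_gt0.
have q1h' : (sqrtD1 h' k')^-1 > 0 by rewrite invr_gt0 sqrtD1_gt0.
have q2h' : (sqrtD2 h' k')^-1 > 0 by rewrite invr_gt0 sqrtD2_gt0.
split.
- rewrite !mulmxA -(mulmxA _ (eigV h' k') (eigV h' k')^T) Wo' mulmx1.
  rewrite -(mulmxA _ (sgnJ s)) sgnJ_absE mulmxBr mulmxBl -Tm_spectral//.
  by rewrite scalar_mxC -(mulmxA s%:M) Vo mulmx1.
- rewrite /orthogonal_mx !trmx_mul trmxK tr_sgnJ !mulmxA -(mulmxA _ (eigV h k) (eigV h k)^T) Vo'.
  by rewrite mulmx1 -(mulmxA _ (sgnJ s) (sgnJ s)) sgnJ_sq// mulmx1.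
- move=> i j; rewrite !mxE !sum3E !mxE !sum3E !mxE.
  move: (sqrtD1 h k)^-1 (sqrtD2 h k)^-1 (sqrtD1 h' k')^-1 (sqrtD2 h' k')^-1 => r t r' t'.
  by elim/ord3P: i; elim/ord3P: j => //= _; rewrite /h' /k' /shifth /shiftk; field.
- move=> i; rewrite !mxE !sum3E !mxE !sum3E !mxE.
  have hb : -1 / 10 <= h <= 1 / 10 by clear - hs; move: hs; rewrite ler_norml; lra.
  have sb : -1 / 10 <= s <= 1 / 10 by clear - ss; move: ss; rewrite ler_norml; lra.
  have hb' : -1 / 4 <= h' <= 1 / 4 by clear - h'_small; move: h'_small; rewrite ler_norml; lra.
  have kk : 0 <= k * k'.
    rewrite /k' mulrA mulr_ge0 ?invr_ge0 ?(ltW d)//.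
    by rewrite mulrCA mulr_ge0// -expr2 sqr_ge0.
  have sp : 0 < `|s| by rewrite normr_gt0.
  have kk1 : k * k' <= 1 / 50.
    rewrite /k' mulrA ler_pdivrMr// mulrCA.
    have : k * k <= 1 / 10 * (1 / 10).
      by rewrite -expr2 -real_normK ?num_real// expr2 ler_pM.
    have kp : 0 <= k * k by rewrite -expr2 sqr_ge0.
    move=> kb; have := ler_pM (ltW sp) kp ss kb.
    by clear - d0; lra.
  move: (sqrtD1 h k)^-1 (sqrtD2 h k)^-1 (sqrtD1 h' k')^-1 (sqrtD2 h' k')^-1 q1h q2h q1h' q2h' => r t r' t' r0 t0 r0' t0'.
  clear h'_small h'1 Wo Wo'; move: @h' @k' hb' kk kk1 => h' k'; move: h' k' => g c hb' kk kk1.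
  elim/ord3P: i => /=.
  + set X := (X in 0 < X).
    have -> : X = r * r' * ((1 + h) * (1 + g) * (1 - s) + (1 - h) * (1 - g) * (1 + s) + `|s| * (k * c)).
      by rewrite {}/X; ring.
    rewrite pmulr_rgt0 ?mulr_gt0//.
    have a1 : 0 < (1 + h) * (1 + g) * (1 - s) by rewrite !mulr_gt0//; clear - hb sb hb'; lra.
    have a2 : 0 < (1 - h) * (1 - g) * (1 + s) by rewrite !mulr_gt0//; clear - hb sb hb'; lra.
    have a3 : 0 <= `|s| * (k * c) by rewrite mulr_ge0.
    by clear - a1 a2 a3; lra.
  + set X := (X in 0 < X).
    have -> : X = r * t * (r' * t') * ((1 + h) * (1 + g) * (1 - s) *
          ((2 * (1 - h) ^+ 2 + k ^+ 2) * (2 * (1 - g) ^+ 2 + c ^+ 2)) +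
        (1 - h) * (1 - g) * (1 + s) *
          ((2 * (1 + h) ^+ 2 + k ^+ 2) * (2 * (1 + g) ^+ 2 + c ^+ 2)) +
        16 * (h * g * `|s|) * (k * c)).
      by rewrite {}/X; ring.
    rewrite pmulr_rgt0 ?mulr_gt0//.
    have m1b : 1 <= 2 * (1 - h) ^+ 2 + k ^+ 2 by have := sqr_ge0 k; clear - hb; nra.
    have n1b : 1 <= 2 * (1 - g) ^+ 2 + c ^+ 2 by have := sqr_ge0 c; clear - hb'; nra.
    have m2b : 0 <= 2 * (1 + h) ^+ 2 + k ^+ 2 by apply: addr_ge0; [apply: mulr_ge0|]; rewrite ?sqr_ge0.
    have n2b : 0 <= 2 * (1 + g) ^+ 2 + c ^+ 2 by apply: addr_ge0; [apply: mulr_ge0|]; rewrite ?sqr_ge0.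
    have mn := mulr_ge0 m2b n2b.
    have nm := @ler_pM R 1 _ 1 _ ler01 ler01 m1b n1b.
    rewrite mulr1 in nm.
    move: ((2 * (1 + h) ^+ 2 + k ^+ 2) * _) ((2 * (1 - h) ^+ 2 + k ^+ 2) * _) mn nm => N M mn nm.
    have a1 : 1 / 2 <= (1 + h) * (1 + g) * (1 - s).
      have e1 : 9 / 10 * (3 / 4) <= (1 + h) * (1 + g) by rewrite ler_pM//; clear - hb sb hb'; lra.
      have e2 : 9 / 10 <= 1 - s by clear - sb; lra.
      have e3 : 0 <= 9 / 10 * (3 / 4) :> R by clear; lra.
      have e4 : 0 <= 9 / 10 :> R by clear; lra.
      by have := ler_pM e3 e4 e1 e2; clear; lra.
    have a2 : 0 <= (1 - h) * (1 - g) * (1 + s) * N.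
      by apply: mulr_ge0 => //; apply: mulr_ge0; [apply: mulr_ge0|]; clear - hb sb hb'; lra.
    have a1' : 1 / 2 <= (1 + h) * (1 + g) * (1 - s) * M.
      have e3 : 0 <= 1 / 2 :> R by clear; lra.
      by have := ler_pM e3 ler01 a1 nm; clear; lra.
    (* The last summand is the only one of unknown sign; even with its factor 16 it stays below the
       1/2 contributed by the first. *)
    have a3 : `|h * g * `|s| | <= 1 / 10.
      rewrite !normrM normr_id.
      have : `|h| * `|g| <= 1 / 10 * (1 / 4) by rewrite ler_pM//; rewrite ler_norml; clear - hb'; lra.
      move=> hg; have := ler_pM (mulr_ge0 (normr_ge0 h) (normr_ge0 g)) (ltW sp) hg ss; clear; lra.
    have a4 : `|h * g * `|s| * (k * c)| <= 1 / 100.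
      rewrite normrM (ger0_norm kk).
      have := ler_pM (normr_ge0 _) kk a3 kk1; clear; lra.
    move: a4; rewrite ler_norml => /andP[a4 _].
    by clear - a1' a2 a4; lra.
  + set X := (X in 0 < X).
    have -> : X = t * t' * (k * c * ((1 - h) * (1 - g) * (1 - s)) + k * c * ((1 + h) * (1 + g) * (1 + s))
         + 4 * `|s| * ((1 - h ^+ 2) * (1 - g ^+ 2))).
      by rewrite {}/X; ring.
    rewrite pmulr_rgt0 ?mulr_gt0//.
    have a1 : 0 <= k * c * ((1 - h) * (1 - g) * (1 - s)) by apply: mulr_ge0 => //; apply: mulr_ge0; [apply: mulr_ge0|]; clear - hb sb hb'; lra.
    have a2 : 0 <= k * c * ((1 + h) * (1 + g) * (1 + s)) by apply: mulr_ge0 => //; apply: mulr_ge0; [apply: mulr_ge0|]; clear - hb sb hb'; lra.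
    have a3 : 0 < 4 * `|s| * ((1 - h ^+ 2) * (1 - g ^+ 2)).
      by rewrite !mulr_gt0//; [clear - hb|clear - hb']; nra.
    by clear - a1 a2 a3; lra.
Qed.

Lemma qr_step_Tm s h k : `|h| <= 1 / 10 -> `|k| <= 1 / 10 -> `|s| <= 1 / 10 -> s != 0 ->
  qr_step s (Tm h k) = Tm (shifth s h) (shiftk s h k).
Proof.
move=> hs ks ss s0; have QR := eigV_QR hs ks ss s0.
have h1 : `|h| < 1 by clear - hs; lra.
have h'1 : `|shifth s h| < 1 by have := shifth_small hs ss; clear; lra.
set Q := (X in is_QR _ X _) in QR; set U := (X in is_QR _ _ X) in QR.
have T' : Tm (shifth s h) (shiftk s h k) = Q^T *m Tm h k *m Q.
  rewrite [Tm h k]Tm_spectral// conj_chain ?eigV_orth ?eigV_orthr// -?Tm_spectral//.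
  - exact: sgnJ_sq.
  - exact: sgnJ_Lambda.
  - exact: tr_sgnJ.
rewrite /qr_step; apply: xget_unique; first by exists Q, U.
by move=> T [Q' [U' [QR' ->]]]; rewrite T' (qr_unique QR' QR).
Qed.

End Mat3.

(** * Wilkinson's step *)

Section Wilkinson.
Variable R : realType.
Implicit Types (h k s a b u : R) (T : 'M[R]_3).

Lemma det2E (F : comPzRingType) (A : 'M[F]_2) : \det A = A 0 0 * A 1 1 - A 0 1 * A 1 0.
Proof.
rewrite (expand_det_row _ 0) !big_ord_recl big_ord0 addr0 /cofactor !det_mx11 !mxE.
have -> : lift 0 0 = 1 :> 'I_2 by apply: val_inj.
have -> : lift 1 0 = 0 :> 'I_2 by apply: val_inj.
by rewrite /= expr0 expr1 mul1r mulN1r mulrN.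
Qed.

Lemma eigenvalue2 (A : 'M[R]_2) a :
  (a \in eigenvalue A) = ((a - A 0 0) * (a - A 1 1) - A 0 1 * A 1 0 == 0).
Proof.
rewrite -[_ \in _]/(eigenvalue A a) eigenvalue_root_char rootE /char_poly det2E !mxE !hornerE /=.
by congr (_ == 0); rewrite ?mulr1n ?mulr0n ?hornerE; ring.
Qed.

Lemma bottom_blockE T : [/\ bottom_block T 0 0 = T 1 1, bottom_block T 0 1 = T 1 2,
  bottom_block T 1 0 = T 2 1 & bottom_block T 1 1 = T 2 2].
Proof. by split; rewrite !mxE; congr (T _ _); apply: val_inj. Qed.

Lemma sup_pair a b : a <= b -> sup [set a; b] = b.
Proof.
move=> ab; apply/eqP; rewrite eq_le; apply/andP; split.
  by apply: ge_sup; [exists a; left|move=> x [->|->]].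
by apply: ub_le_sup; [exists b => x [->|->]|right].
Qed.

Lemma inf_pair a b : a <= b -> inf [set a; b] = a.
Proof.
move=> ab; apply/eqP; rewrite eq_le; apply/andP; split.
  by apply: ge_inf; [exists a => x [->|->]|left].
by apply: lb_le_inf; [exists a; left|move=> x [->|->]].
Qed.

Lemma Tm_entries h k : [/\ Tm h k 0 0 = 4 * h / D1 h k, Tm h k 0 1 = sqrtD2 h k / D1 h k,
  Tm h k 1 2 = 2 * (1 - h ^+ 2) * k * sqrtD1 h k / D2 h k,
  Tm h k 2 2 = - (4 * h * k ^+ 2) / D2 h k &
  Tm h k 1 1 = - (4 * h / D1 h k) - (- (4 * h * k ^+ 2) / D2 h k)].
Proof. by split; rewrite !mxE. Qed.

Lemma Tm_sym h k i j : Tm h k i j = Tm h k j i.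
Proof. by rewrite !mxE; elim/ord3P: i; elim/ord3P: j. Qed.

(** Origin of the quadratic equation behind [wshift]: its left side over D1 is the characteristic
    polynomial of the bottom block. *)
Lemma Tm_block_det h k a : `|h| < 1 ->
  (a - Tm h k 1 1) * (a - Tm h k 2 2) - Tm h k 1 2 * Tm h k 2 1 =
  (D1 h k * a ^+ 2 + 4 * h * a - k ^+ 2) / D1 h k.
Proof.
move=> h1; have E1 := sqrtD1_sq h k; have n2 := D2_gt0 k h1; have n1 := D1_gt0 h k.
rewrite (Tm_sym h k 2 1); have [_ _ -> -> ->] := Tm_entries h k.
have {}n1 : D1 h k != 0 by rewrite gt_eqF.
have {}n2 : D2 h k != 0 by rewrite gt_eqF.
move: (sqrtD1 h k) E1 => r E1; rewrite /D2 /D1 in E1 n1 n2 *.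
by field: E1; rewrite ?n1 ?n2.
Qed.

Definition disc h k : R := 4 * h ^+ 2 + D1 h k * k ^+ 2.
Definition root_plus h k : R := (Num.sqrt (disc h k) - 2 * h) / D1 h k.
Definition root_minus h k : R := (- Num.sqrt (disc h k) - 2 * h) / D1 h k.

Lemma disc_ge0 h k : 0 <= disc h k.
Proof.
apply: addr_ge0; apply: mulr_ge0; rewrite ?sqr_ge0//; exact/ltW/D1_gt0.
Qed.

Lemma block_spectrum_Tm h k : `|h| < 1 ->
  block_spectrum (Tm h k) = [set root_minus h k; root_plus h k].
Proof.
move=> h1; have n0 := D1_gt0 h k; have n1 : D1 h k != 0 by rewrite gt_eqF.
have fac a : D1 h k * a ^+ 2 + 4 * h * a - k ^+ 2 =
    D1 h k * ((a - root_minus h k) * (a - root_plus h k)).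
  have := sqr_sqrtr (disc_ge0 h k); rewrite /root_minus /root_plus /disc.
  by move: (D1 h k) n1 => A n1; move: (Num.sqrt _) => q E; field: E.
apply/seteqP; split => a; rewrite /block_spectrum /= eigenvalue2;
  have [-> -> -> ->] := bottom_blockE (Tm h k); rewrite Tm_block_det// fac;
  rewrite !mulf_eq0 invr_eq0 (negbTE n1) /= orbF !subr_eq0.
- by case/orP => /eqP; [left|right].
- by case=> ->; rewrite eqxx ?orbT.
Qed.

Lemma root_minusN h k : root_minus h k = - wshift (- h) k.
Proof.
by rewrite /wshift /D1 /root_minus /disc /D1 !sqrrN -[RHS]mulNr; congr (_ / _); ring.
Qed.

(** The roots have sum -4 h / D1 and T_33 is only of order h k^2, so the sign of h decides which
    root is nearer. At h = 0 there is a tie, and the convention for [omega] agrees with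
    [sg (0 <= 0) = 1]. *)
Lemma omega_Tm h k : `|h| <= 1 / 10 -> `|k| <= 1 / 10 ->
  omega (Tm h k) = sg (0 <= h) * wshift `|h| k.
Proof.
move=> hs ks; have h1 : `|h| < 1 by clear - hs; lra.
have n1 := D1_gt0 h k; have n2 := D2_gt0 k h1.
have q0 := sqrtr_ge0 (disc h k).
have le : root_minus h k <= root_plus h k.
  by rewrite ler_pM2r ?invr_gt0// lerD2r; clear - q0; lra.
rewrite /omega /omega_minus /omega_plus block_spectrum_Tm// sup_pair// inf_pair//.
have -> : (`|root_minus h k - Tm h k 2 2| < `|root_plus h k - Tm h k 2 2|) = (h < 0).
  have [_ _ _ -> _] := Tm_entries h k.
  set z := (X in _ - X).
  have -> : `|root_minus h k - z| < `|root_plus h k - z| =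
      (0 < (root_plus h k - z) ^+ 2 - (root_minus h k - z) ^+ 2).
    by rewrite subr_gt0 -[X in _ = (X < _)]real_normK ?num_real//
      -[X in _ = (_ < X)]real_normK ?num_real// ltr_sqr ?nnegrE.
  have -> : (root_plus h k - z) ^+ 2 - (root_minus h k - z) ^+ 2 =
     8 * (Num.sqrt (disc h k) * - h) * ((D2 h k - 2 * k ^+ 2 * D1 h k) / (D1 h k ^+ 2 * D2 h k)).
    rewrite /z /root_plus /root_minus.
    by field; rewrite !gt_eqF.
  have c : 0 < (D2 h k - 2 * k ^+ 2 * D1 h k) / (D1 h k ^+ 2 * D2 h k).
    apply: divr_gt0; last by rewrite mulr_gt0// exprn_gt0.
    have h2 : h ^+ 2 <= 1 / 10 by rewrite -real_normK ?num_real//; have := normr_ge0 h; clear - hs; rewrite expr2; nra.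
    have k2 : k ^+ 2 <= 1 / 10 by rewrite -real_normK ?num_real//; have := normr_ge0 k; clear - ks; rewrite expr2; nra.
    rewrite /D1 /D2; have := sqr_ge0 h; have := sqr_ge0 k; clear - h2 k2.
    by move: (h ^+ 2) (k ^+ 2) h2 k2 => x y *; nra.
  rewrite (pmulr_lgt0 _ c) (pmulr_rgt0 (Num.sqrt (disc h k) * - h)); last by rewrite ltr0n.
  have [h0|h0] := ltP h 0.
    rewrite mulr_gt0 ?oppr_gt0// sqrtr_gt0 /disc.
    apply: ltr_wpDr; first by apply: mulr_ge0; [exact: ltW|exact: sqr_ge0].
    by rewrite mulr_gt0// exprn_even_gt0//= lt_eqF.
  by apply/negbTE; rewrite -leNgt mulr_ge0_le0// oppr_le0.
rewrite /sg leNgt; case: ltP => h0 /=.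
  by rewrite mulN1r ltr0_norm// root_minusN.
by rewrite mul1r ger0_norm.
Qed.

Lemma wshift_le_tenth u k : 0 <= u -> `|k| <= 1 / 10 -> wshift u k <= 1 / 10.
Proof. by move=> u0 k1; have := wshift_upper k u0; clear - k1; have := normr_ge0 k; lra. Qed.

Lemma shifth_sg h s : 0 <= s ->
  shifth (sg (0 <= h) * s) h = sg (0 <= h) * ((`|h| - s) / (1 - s * `|h|)).
Proof.
move=> s0; rewrite /shifth /sg; case: ifPn => [h0|]; first by rewrite !mul1r (ger0_norm h0).
rewrite -ltNge => h0; rewrite (ltr0_norm h0) !mulN1r -[RHS]mulNr; congr (_ / _); ring.
Qed.

Lemma shiftk_sg h k s : 0 <= s ->
  shiftk (sg (0 <= h) * s) h k = s * k / (1 - s * `|h|).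
Proof.
move=> s0; rewrite /shiftk normrM (ger0_norm s0) /sg.
case: ifPn => [h0|]; first by rewrite normr1 !mul1r (ger0_norm h0).
rewrite -ltNge => h0; rewrite (ltr0_norm h0) normrN normr1 mul1r; congr (_ / _); ring.
Qed.

Lemma mx3_cvg (T : Type) (F : set_system T) {FF : Filter F} (f : T -> 'M[R]_3) (M : 'M[R]_3) :
  (forall i j, f x i j @[x --> F] --> M i j) -> f @ F --> M.
Proof.
move=> H; apply/cvg_ballP => e e0.
have : \forall x \near F, forall i j, ball (M i j) e (f x i j).
  apply: filter_forall => i; apply: filter_forall => j.
  by have /cvg_ballP := H i j; apply.
by apply: filterS => x Hx; split=> // i j; exact: Hx.
Qed.

Lemma Tm_cvg (T : Type) (F : set_system T) {FF : Filter F} (x y : T -> R) h k :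
  `|h| < 1 -> x @ F --> h -> y @ F --> k -> Tm (x t) (y t) @[t --> F] --> Tm h k.
Proof.
move=> h1 xh yk.
have sq (z : T -> R) (c : R) : z @ F --> c -> z t ^+ 2 @[t --> F] --> c ^+ 2.
  by move=> zc; rewrite expr2; under eq_fun do rewrite expr2; exact: cvgM.
have x2 : x t ^+ 2 @[t --> F] --> h ^+ 2 by exact: (sq _ _ xh).
have y2 : y t ^+ 2 @[t --> F] --> k ^+ 2 by exact: (sq _ _ yk).
have cC (c : R) : (c : R) @[t --> F] --> (c : R) by exact: cvg_cst.
have d1 : D1 (x t) (y t) @[t --> F] --> D1 h k.
  exact: cvgD (cvgD (cC 2) (cvgM (cC 2) x2)) y2.
have hh : 1 - x t ^+ 2 @[t --> F] --> 1 - h ^+ 2 by apply: cvgB.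
have d2 : D2 (x t) (y t) @[t --> F] --> D2 h k.
  exact: cvgD (cvgM (cC 4) (sq _ _ hh)) (cvgM y2 (cvgD (cC 2) (cvgM (cC 2) x2))).
have r1 : sqrtD1 (x t) (y t) @[t --> F] --> sqrtD1 h k by exact: continuous_cvg (@sqrt_continuous R _) d1.
have r2 : sqrtD2 (x t) (y t) @[t --> F] --> sqrtD2 h k by exact: continuous_cvg (@sqrt_continuous R _) d2.
have i1 : (D1 (x t) (y t))^-1 @[t --> F] --> (D1 h k)^-1 by apply: cvgV => //; rewrite gt_eqF ?D1_gt0.
have i2 : (D2 (x t) (y t))^-1 @[t --> F] --> (D2 h k)^-1 by apply: cvgV => //; rewrite gt_eqF ?D2_gt0.
have A1 : 4 * x t / D1 (x t) (y t) @[t --> F] --> 4 * h / D1 h k by exact: cvgM (cvgM (cC 4) xh) i1.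
have B1 : sqrtD2 (x t) (y t) / D1 (x t) (y t) @[t --> F] --> sqrtD2 h k / D1 h k by exact: cvgM r2 i1.
have A3 : - (4 * x t * y t ^+ 2) / D2 (x t) (y t) @[t --> F] --> - (4 * h * k ^+ 2) / D2 h k.
  exact: cvgM (cvgN (cvgM (cvgM (cC 4) xh) y2)) i2.
have B2 : 2 * (1 - x t ^+ 2) * y t * sqrtD1 (x t) (y t) / D2 (x t) (y t) @[t --> F] -->
    2 * (1 - h ^+ 2) * k * sqrtD1 h k / D2 h k.
  exact: cvgM (cvgM (cvgM (cvgM (cC 2) hh) yk) r1) i2.
apply: mx3_cvg => i j; rewrite !mxE; under eq_fun do rewrite mxE.
elim/ord3P: i; elim/ord3P: j => /=;
  first [exact: cC|exact: A1|exact: B1|exact: B2|exact: A3|exact: cvgB (cvgN A1) A3].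
Qed.

Lemma in_box_tenth (p : R * R) : in_box p -> `|p.1| <= 1 / 10 /\ `|p.2| <= 1 / 10.
Proof. by case=> a b; have := @radiusE R; split; clear - a b H; lra. Qed.

Lemma wilkinson_Tm (p : R * R) : in_box p ->
  wilkinson (Tm p.1 p.2) = Tm (step p).1 (step p).2.
Proof.
case: p => h k hkb; have [/= hs ks] := in_box_tenth hkb.
have h1 : `|h| < 1 by clear - hs; lra.
have u0 := normr_ge0 h.
rewrite /wilkinson omega_Tm// /step /= /nextu /nextk.
have s0 := wshift_ge0 k u0; have s1 := wshift_le_tenth u0 ks.
have en : `|sg (0 <= h) * wshift `|h| k| = wshift `|h| k.
  by rewrite normrM sg_norm mul1r ger0_norm.
have E0 : (sg (0 <= h) * wshift `|h| k == 0) = (k == 0).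
  by rewrite -normr_eq0 en wshift_eq0.
rewrite /shifted_step E0; case: eqVneq => [k0|kn0]; last first.
  rewrite qr_step_Tm ?en ?E0 ?shifth_sg ?shiftk_sg//.
(* For k = 0 the shift vanishes and the step is the limit of QR steps with shift t -> 0; they act on
   (h, 0) by [shifth t h], which tends to h, so the matrix is fixed. *)
rewrite k0 wshift0// subr0 !mul0r subr0 divr1 sg_abs.
apply: cvg_lim; first exact: norm_hausdorff.
have t0 : t @[t --> (0 : R)^'] --> (0 : R) by exact: cvg_within.
have cC (c : R) : (c : R) @[t --> (0 : R)^'] --> (c : R) by exact: cvg_cst.
have den : (1 - t * h)^-1 @[t --> (0 : R)^'] --> (1 - 0 * h)^-1.
  apply: cvgV; first by rewrite mul0r subr0 oner_neq0.
  by apply: cvgB => //; exact: cvgM.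
have lim1 : shifth t h @[t --> (0 : R)^'] --> (h - 0) * (1 - 0 * h)^-1.
  exact: cvgM (cvgB (cC h) t0) den.
rewrite mul0r !subr0 invr1 mulr1 in lim1.
have lim2 : shiftk t h 0 @[t --> (0 : R)^'] --> (0 : R).
  have -> : (fun t => shiftk t h 0) = (fun=> 0) by apply/funext => t; rewrite /shiftk mulr0 mul0r.
  exact: cC.
apply: cvg_trans (Tm_cvg h1 lim1 lim2).
apply: near_eq_cvg; near=> t.
have tn : t != 0 by near: t; exact: nbhs_dnbhs_neq.
have ts : `|t| <= 1 / 10.
  by near: t; have /cvgr0Pnorm_le H := t0; apply: H; lra.
by rewrite qr_step_Tm// normr0; lra.
Unshelve. all: by end_near.
Qed.

End Wilkinson.

(** * The inverse chart *)

Section Chart.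
Variable R : realType.
Implicit Types (h k s a b u : R) (T P : 'M[R]_3).

Lemma T_Lambda_traces T : T_Lambda T ->
  [/\ \tr T = 0, \tr (T *m T) = 2 & \tr (T *m T *m T) = 0].
Proof.
case=> _ _ [P Pu /eqP]; rewrite conjumx// => PT.
have trc (A : 'M[R]_3) : \tr (P *m A *m invmx P) = \tr A.
  by rewrite mxtrace_mulC mulmxA mulVmx// mul1mx.
have mulc (A B : 'M[R]_3) :
    P *m (A *m B) *m invmx P = (P *m A *m invmx P) *m (P *m B *m invmx P).
  by rewrite !mulmxA mulmxKV.
rewrite -(trc T) -(trc (T *m T)) -(trc (T *m T *m T)) !mulc PT LambdaE.
by split; rewrite /mxtrace sum3E !mxE ?sum3E ?mxE ?sum3E ?mxE /=; ring.
Qed.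

Lemma T_Lambda_entries T : T_Lambda T ->
  [/\ T 1 0 = T 0 1, T 2 1 = T 1 2, T 0 2 = 0 & T 2 0 = 0].
Proof.
case=> sym tri _; split; [| |exact: tri|exact: tri].
- by rewrite -{1}sym mxE.
- by rewrite -{1}sym mxE.
Qed.

(** By Newton's identities the three power traces give the characteristic polynomial: trace 0,
    principal 2 by 2 minors of sum -1 (simplified with the trace), determinant 0. *)
Lemma T_Lambda_eqs T : T_Lambda T ->
  [/\ T 0 0 + T 1 1 + T 2 2 = 0,
      T 1 1 * T 2 2 - T 1 2 ^+ 2 = T 0 0 ^+ 2 + T 0 1 ^+ 2 - 1
    & T 0 0 * (T 1 1 * T 2 2 - T 1 2 ^+ 2) = T 2 2 * T 0 1 ^+ 2].
Proof.
move=> TL; have [t1 t2 t3] := T_Lambda_traces TL.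
have [e1 e2 e3 e4] := T_Lambda_entries TL.
move: t1 t2 t3; rewrite /mxtrace !sum3E !mxE !sum3E !mxE !sum3E e1 e2 e3 e4.
move: (T 0 0) (T 1 1) (T 2 2) (T 0 1) (T 1 2) => a1 a2 a3 b1 b2 t1 t2 t3.
have a3E : a3 = - a1 - a2 by rewrite -[RHS]addr0 -t1; ring.
split=> //; rewrite a3E in t2 t3 *; first by lra.
have : 3 * (a1 * (a2 * (- a1 - a2) - b2 ^+ 2) - (- a1 - a2) * b1 ^+ 2) = 0.
  by rewrite -t3; ring.
by move=> /eqP; rewrite mulf_eq0 pnatr_eq0 /= subr_eq0 => /eqP.
Qed.

Lemma Tm_T_Lambda h k : `|h| < 1 -> T_Lambda (Tm h k).
Proof.
move=> h1; have V1 := eigV_orthr k h1; split.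
- by apply/matrixP => i j; rewrite mxE Tm_sym.
- by move=> i j; rewrite mxE; elim/ord3P: i; elim/ord3P: j.
- exists (eigV h k); first by have [] := mulmx1_unit V1.
  apply/eqP; rewrite conjumx; last by have [] := mulmx1_unit V1.
  have -> : invmx (eigV h k) = (eigV h k)^T.
    by rewrite -[LHS]mulmx1 -V1 mulKmx//; have [] := mulmx1_unit V1.
  by rewrite Tm_spectral// !mulmxA V1 mul1mx -mulmxA V1 mulmx1.
Qed.

(** As T_12 (in the usual numbering) is nonzero, the determinant equation gives the last diagonal
    entry, the trace the middle one, and the minors the square of T_23; the last hypothesis settles
    its sign. *)
Lemma T_Lambda_inj T T' : T_Lambda T -> T_Lambda T' ->
  T 0 0 = T' 0 0 -> 0 < T 0 1 -> 0 < T' 0 1 -> T 0 1 ^+ 2 = T' 0 1 ^+ 2 ->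
  0 <= T 1 2 * T' 1 2 -> T = T'.
Proof.
move=> TL TL' a b0 b0' b2 c0.
have b : T 0 1 = T' 0 1.
  by apply/eqP; rewrite -(@eqrXn2 _ 2) ?ltW// b2.
have [t1 t2 t3] := T_Lambda_eqs TL; have [t1' t2' t3'] := T_Lambda_eqs TL'.
have [e1 e2 e3 e4] := T_Lambda_entries TL; have [e1' e2' e3' e4'] := T_Lambda_entries TL'.
have a3 : T 2 2 = T' 2 2.
  have bn : T' 0 1 ^+ 2 != 0 by rewrite expf_neq0// gt_eqF.
  by apply: (mulIf bn); rewrite -t3' -b2 -t3 t2 t2' a b.
have a2 : T 1 1 = T' 1 1.
  by apply: (addrI (T 0 0)); apply: (addIr (T 2 2)); rewrite t1 a a3 t1'.
have c2 : T 1 2 ^+ 2 = T' 1 2 ^+ 2.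
  by move: t2; rewrite a b a3 a2 -t2' => /addrI /oppr_inj.
have c : T 1 2 = T' 1 2.
  move/eqP: c2; rewrite eqf_sqr => /orP[/eqP//|/eqP cE].
  move: c0; rewrite cE mulNr oppr_ge0 -expr2 => c0.
  have : T' 1 2 ^+ 2 = 0 by apply/eqP; rewrite eq_le c0 sqr_ge0.
  by move/eqP; rewrite sqrf_eq0 => /eqP ->; rewrite oppr0.
apply/matrixP => i j; elim/ord3P: i; elim/ord3P: j => //.
- by rewrite e3 e3'.
- by rewrite e1 e1'.
- by rewrite e4 e4'.
- by rewrite e2 e2'.
Qed.

(** The (0, 0) entry of [T *m T] for symmetric tridiagonal T. *)
Definition first_sq T : R := T 0 0 ^+ 2 + T 0 1 ^+ 2.
(* Square roots of the diagonal entries of spectral projections of T, which are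
   polynomials in T: the weights of the first basis vector for the eigenvalues
   1 and -1, and the weight of the last one for 0. *)
Definition wt_plus T : R := Num.sqrt ((first_sq T + T 0 0) / 2).
Definition wt_minus T : R := Num.sqrt ((first_sq T - T 0 0) / 2).
Definition wt_last T : R := Num.sqrt (T 0 1 ^+ 2 - T 0 0 * T 1 1).
Definition wt_sum T : R := wt_plus T + wt_minus T.
Definition chartH T : R := (wt_plus T - wt_minus T) / wt_sum T.
(** [T 0 1 * T 1 2] is the (0, 2) entry of T^2, hence up to sign that of the projection 1 - T^2 for
    the eigenvalue 0. Dividing by [wt_last] leaves the first weight for 0, with the sign of k that a
    square root would lose. *)
Definition chartK T : R := 2 * T 0 1 * T 1 2 / (wt_last T * wt_sum T).

(** Every condition is the positivity of a continuous function free of quotients, so openness is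
    immediate. The last two amount to the box bounds on [chartH] and [chartK]. *)
Definition chartV : set 'M[R]_3 :=
  [set T : 'M[R]_3 | 0 < T 0 1] `&` [set T : 'M[R]_3 | 0 < first_sq T + T 0 0] `&`
  [set T : 'M[R]_3 | 0 < first_sq T - T 0 0] `&` [set T : 'M[R]_3 | 0 < T 0 1 ^+ 2 - T 0 0 * T 1 1] `&`
  [set T : 'M[R]_3 | 0 < radius * wt_sum T - `|wt_plus T - wt_minus T|] `&`
  [set T : 'M[R]_3 | 0 < radius * (wt_last T * wt_sum T) - `|2 * T 0 1 * T 1 2|].

Lemma open_pos (f : 'M[R]_3 -> R) : continuous f -> open [set T : 'M[R]_3 | 0 < f T].
Proof.
move=> cf; rewrite -[X in open X]/(f @^-1` [set x | 0 < x]).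
by apply: open_comp => [? ?|]; [exact: cf|exact: open_gt].
Qed.

Lemma entry_cvg i j T : T' i j @[T' --> T] --> T i j.
Proof. exact: coord_continuous. Qed.

Lemma sq_cvg i j T : T' i j ^+ 2 @[T' --> T] --> T i j ^+ 2.
Proof.
by rewrite expr2; under eq_fun do rewrite expr2; apply: cvgM; exact: entry_cvg.
Qed.

Lemma first_sq_continuous : continuous first_sq.
Proof. by move=> T; exact: (cvgD (@sq_cvg 0 0 T) (@sq_cvg 0 1 T)). Qed.

Lemma wt_plus_continuous : continuous wt_plus.
Proof.
move=> T; apply: (@continuous_comp _ _ _ (fun T => (first_sq T + T 0 0) / 2) Num.sqrt);
  last exact: sqrt_continuous.
exact: cvgM (cvgD (@first_sq_continuous T) (@entry_cvg 0 0 T)) (cvg_cst _).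
Qed.

Lemma wt_minus_continuous : continuous wt_minus.
Proof.
move=> T; apply: (@continuous_comp _ _ _ (fun T => (first_sq T - T 0 0) / 2) Num.sqrt);
  last exact: sqrt_continuous.
exact: cvgM (cvgB (@first_sq_continuous T) (@entry_cvg 0 0 T)) (cvg_cst _).
Qed.

Lemma wt_last_sq_continuous : continuous (fun T => T 0 1 ^+ 2 - T 0 0 * T 1 1).
Proof.
by move=> T; exact: (cvgB (@sq_cvg 0 1 T) (cvgM (@entry_cvg 0 0 T) (@entry_cvg 1 1 T))).
Qed.

Lemma wt_last_continuous : continuous wt_last.
Proof.
move=> T; apply: (@continuous_comp _ _ _ (fun T => T 0 1 ^+ 2 - T 0 0 * T 1 1) Num.sqrt);
  last exact: sqrt_continuous.
exact: wt_last_sq_continuous.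
Qed.

Lemma wt_sum_continuous : continuous wt_sum.
Proof. by move=> T; exact: cvgD (@wt_plus_continuous T) (@wt_minus_continuous T). Qed.

Lemma last_product_continuous : continuous (fun T => 2 * T 0 1 * T 1 2).
Proof.
by move=> T; exact: cvgM (cvgM (cvg_cst _) (@entry_cvg 0 1 T)) (@entry_cvg 1 2 T).
Qed.

Lemma chartV_open : open chartV.
Proof.
do !apply: openI; apply: open_pos => T.
- exact: entry_cvg.
- exact: cvgD (@first_sq_continuous T) (@entry_cvg 0 0 T).
- exact: cvgB (@first_sq_continuous T) (@entry_cvg 0 0 T).
- exact: wt_last_sq_continuous.
- exact: cvgB (cvgM (cvg_cst _) (@wt_sum_continuous T))
    (cvg_norm (cvgB (@wt_plus_continuous T) (@wt_minus_continuous T))).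
- exact: cvgB (cvgM (cvg_cst _) (cvgM (@wt_last_continuous T) (@wt_sum_continuous T)))
    (cvg_norm (@last_product_continuous T)).
Qed.

Lemma D2E h k : D2 h k = D1 h k * (2 + 2 * h ^+ 2) - 16 * h ^+ 2.
Proof. by rewrite /D1 /D2; ring. Qed.

Lemma first_sq_Tm h k : `|h| < 1 -> first_sq (Tm h k) = (2 + 2 * h ^+ 2) / D1 h k.
Proof.
move=> h1; rewrite /first_sq; have [-> -> _ _ _] := Tm_entries h k.
have n1 : D1 h k != 0 by rewrite gt_eqF ?D1_gt0.
by have E := sqrtD2_sq k h1; rewrite D2E in E; move: (sqrtD2 h k) (D1 h k) n1 E => t A n1 E; field: E.
Qed.

Lemma wt_plus_Tm h k : `|h| < 1 -> wt_plus (Tm h k) = (1 + h) / sqrtD1 h k.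
Proof.
move=> h1; rewrite /wt_plus first_sq_Tm//; have [-> _ _ _ _] := Tm_entries h k.
have n1 : sqrtD1 h k != 0 by rewrite gt_eqF ?sqrtD1_gt0.
have -> : ((2 + 2 * h ^+ 2) / D1 h k + 4 * h / D1 h k) / 2 = ((1 + h) / sqrtD1 h k) ^+ 2.
  by rewrite -sqrtD1_sq; field.
rewrite sqrtr_sqr ger0_norm// divr_ge0 ?(ltW (sqrtD1_gt0 _ _))//.
by move: h1; rewrite ltr_norml; lra.
Qed.

Lemma wt_minus_Tm h k : `|h| < 1 -> wt_minus (Tm h k) = (1 - h) / sqrtD1 h k.
Proof.
move=> h1; rewrite /wt_minus first_sq_Tm//; have [-> _ _ _ _] := Tm_entries h k.
have n1 : sqrtD1 h k != 0 by rewrite gt_eqF ?sqrtD1_gt0.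
have -> : ((2 + 2 * h ^+ 2) / D1 h k - 4 * h / D1 h k) / 2 = ((1 - h) / sqrtD1 h k) ^+ 2.
  by rewrite -sqrtD1_sq; field.
rewrite sqrtr_sqr ger0_norm// divr_ge0 ?(ltW (sqrtD1_gt0 _ _))//.
by move: h1; rewrite ltr_norml; lra.
Qed.

Lemma wt_sum_Tm h k : `|h| < 1 -> wt_sum (Tm h k) = 2 / sqrtD1 h k.
Proof.
by move=> h1; rewrite /wt_sum wt_plus_Tm// wt_minus_Tm// -mulrDl; congr (_ / _); ring.
Qed.

Lemma one_sub_sq_gt0 h : `|h| < 1 -> 0 < 1 - h ^+ 2.
Proof.
by move=> h1; rewrite subr_gt0 -real_normK ?num_real// exprn_ilt1.
Qed.

Lemma wt_last_sq_Tm h k : `|h| < 1 ->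
  Tm h k 0 1 ^+ 2 - Tm h k 0 0 * Tm h k 1 1 = (2 * (1 - h ^+ 2) / sqrtD2 h k) ^+ 2.
Proof.
move=> h1; have [-> -> _ _ ->] := Tm_entries h k.
have n1 : D1 h k != 0 by rewrite gt_eqF ?D1_gt0.
have n2 : sqrtD2 h k != 0 by rewrite gt_eqF ?sqrtD2_gt0.
have E := sqrtD2_sq k h1; rewrite -E; move: (sqrtD2 h k) n2 E => t n2 E.
by rewrite /D1 /D2 in n1 E *; field: E; rewrite ?n1 ?n2.
Qed.

Lemma wt_last_Tm h k : `|h| < 1 -> wt_last (Tm h k) = 2 * (1 - h ^+ 2) / sqrtD2 h k.
Proof.
move=> h1; rewrite /wt_last wt_last_sq_Tm// sqrtr_sqr ger0_norm//.
by rewrite divr_ge0 ?(ltW (sqrtD2_gt0 _ h1))// mulr_ge0// ltW// one_sub_sq_gt0.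
Qed.

Lemma chartH_Tm h k : `|h| < 1 -> chartH (Tm h k) = h.
Proof.
move=> h1; rewrite /chartH wt_sum_Tm// wt_plus_Tm// wt_minus_Tm//.
by field; rewrite gt_eqF ?sqrtD1_gt0.
Qed.

Lemma last_product_Tm h k : `|h| < 1 -> 2 * Tm h k 0 1 * Tm h k 1 2 =
  k * (wt_last (Tm h k) * wt_sum (Tm h k)).
Proof.
move=> h1; rewrite wt_last_Tm// wt_sum_Tm//; have [_ -> -> _ _] := Tm_entries h k.
have n1 : sqrtD1 h k != 0 by rewrite gt_eqF ?sqrtD1_gt0.
have n2 : sqrtD2 h k != 0 by rewrite gt_eqF ?sqrtD2_gt0.
by rewrite -sqrtD1_sq -sqrtD2_sq//; field; rewrite n1 n2.
Qed.

Lemma wt_prod_Tm_gt0 h k : `|h| < 1 -> 0 < wt_last (Tm h k) * wt_sum (Tm h k).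
Proof.
move=> h1; rewrite wt_last_Tm// wt_sum_Tm// mulr_gt0// divr_gt0 ?sqrtD1_gt0 ?sqrtD2_gt0//.
by rewrite mulr_gt0// one_sub_sq_gt0.
Qed.

Lemma chartK_Tm h k : `|h| < 1 -> chartK (Tm h k) = k.
Proof.
by move=> h1; rewrite /chartK last_product_Tm// mulfK// gt_eqF// wt_prod_Tm_gt0.
Qed.

Lemma chartK_cvg h k : `|h| < 1 -> chartK T @[T --> Tm h k] --> chartK (Tm h k).
Proof.
move=> h1; have wp : wt_last (Tm h k) * wt_sum (Tm h k) != 0.
  by rewrite gt_eqF// wt_prod_Tm_gt0.
exact: cvgM (@last_product_continuous (Tm h k))
  (cvgV wp (cvgM (@wt_last_continuous (Tm h k)) (@wt_sum_continuous (Tm h k)))).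
Qed.

Lemma in_box_lt1 (p : R * R) : in_box p -> `|p.1| < 1.
Proof. by case=> a _; have := @radiusE R; clear - a; lra. Qed.

Lemma Tm_in_chartV (p : R * R) : in_box p -> chartV (Tm p.1 p.2).
Proof.
move=> pb; have h1 := in_box_lt1 pb; case: p pb h1 => h k [/= hr kr] h1.
have qp := sqrtD1_gt0 h k; have Dp := D1_gt0 h k.
have [e00 e01 _ _ _] := Tm_entries h k.
have hb := h1; rewrite ltr_norml in hb.
rewrite /chartV /=; split; [split; [split; [split; [split|]|]|]|].
- by rewrite e01 divr_gt0 ?sqrtD2_gt0.
- rewrite first_sq_Tm// e00 -mulrDl divr_gt0//.
  by have := exprn_gt0 2 (_ : 0 < 1 + h); rewrite sqrrD; move=> /(_ ltac:(lra)); lra.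
- rewrite first_sq_Tm// e00 -mulrBl divr_gt0//.
  by have := exprn_gt0 2 (_ : 0 < 1 - h); rewrite sqrrB; move=> /(_ ltac:(lra)); lra.
- by rewrite wt_last_sq_Tm// exprn_gt0// divr_gt0 ?sqrtD2_gt0// mulr_gt0// one_sub_sq_gt0.
- rewrite wt_sum_Tm// wt_plus_Tm// wt_minus_Tm// -mulrBl.
  have -> : 1 + h - (1 - h) = 2 * h by ring.
  rewrite normrM normfV (gtr0_norm qp) mulrA -mulrBl divr_gt0// normrM.
  by rewrite (gtr0_norm (_ : 0 < 2))// subr_gt0 (mulrC 2) ltr_pM2r.
- rewrite last_product_Tm//; have wp := wt_prod_Tm_gt0 k h1.
  by rewrite normrM (gtr0_norm wp) -mulrBl mulr_gt0// subr_gt0.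
Qed.

(** Through [T_Lambda_inj], it suffices to match [T 0 0], the square of [T 0 1] and the sign of
    [T 1 2]; the key to the first two is D1 = 4 / wt_sum^2. *)
Lemma chart_surj T : chartV T -> T_Lambda T ->
  in_box (chartH T, chartK T) /\ T = Tm (chartH T) (chartK T).
Proof.
move=> [[[[[b0 A0] B0] C0] H0] K0] TL.
have [t1 t2 t3] := T_Lambda_eqs TL.
have p0 : 0 < wt_plus T by rewrite sqrtr_gt0 divr_gt0.
have m0 : 0 < wt_minus T by rewrite sqrtr_gt0 divr_gt0.
have c0 : 0 < wt_last T by rewrite sqrtr_gt0.
have s0 : 0 < wt_sum T by rewrite addr_gt0.
have cs0 := mulr_gt0 c0 s0.
rewrite /= !subr_gt0 in H0 K0.
have box : in_box (chartH T, chartK T).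
  split; rewrite /= /chartH /chartK normrM normfV.
    by rewrite (gtr0_norm s0) ltr_pdivrMr.
  by rewrite (gtr0_norm cs0) ltr_pdivrMr.
have h1 : `|chartH T| < 1 := in_box_lt1 box.
split=> //.
have pE : wt_plus T ^+ 2 = (first_sq T + T 0 0) / 2 by rewrite sqr_sqrtr// ltW// divr_gt0.
have mE : wt_minus T ^+ 2 = (first_sq T - T 0 0) / 2 by rewrite sqr_sqrtr// ltW// divr_gt0.
have cE : wt_last T ^+ 2 = T 0 1 ^+ 2 - T 0 0 * T 1 1 by rewrite sqr_sqrtr// ltW.
have sn : wt_sum T != 0 by rewrite gt_eqF.
have cn : wt_last T != 0 by rewrite gt_eqF.
have kE : chartK T ^+ 2 = 4 * (1 - first_sq T) / wt_sum T ^+ 2.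
  (* The projection P = 1 - T^2 has rank one, so P_02^2 = P_00 P_22; here this is derived from the
     minor and determinant equations. *)
  have : (T 0 1 * T 1 2) ^+ 2 = (1 - first_sq T) * wt_last T ^+ 2.
    rewrite cE /first_sq -opprB -t2.
    have -> : - (T 1 1 * T 2 2 - T 1 2 ^+ 2) * (T 0 1 ^+ 2 - T 0 0 * T 1 1) =
      - (T 1 1 * T 2 2 - T 1 2 ^+ 2) * T 0 1 ^+ 2 +
      T 1 1 * (T 0 0 * (T 1 1 * T 2 2 - T 1 2 ^+ 2)) by ring.
    by rewrite t3; ring.
  rewrite /chartK => E.
  have -> : (2 * T 0 1 * T 1 2 / (wt_last T * wt_sum T)) ^+ 2 =
    4 * (T 0 1 * T 1 2) ^+ 2 / (wt_last T ^+ 2 * wt_sum T ^+ 2).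
    by field; rewrite sn cn.
  by rewrite E; field; rewrite sn cn.
have D1E : D1 (chartH T) (chartK T) = 4 / wt_sum T ^+ 2.
  rewrite /D1 kE /chartH.
  have -> : first_sq T = wt_plus T ^+ 2 + wt_minus T ^+ 2 by rewrite pE mE; field.
  by move: sn; rewrite /wt_sum => sn; field.
have [e00 e01 e12 _ _] := Tm_entries (chartH T) (chartK T).
have a1 : T 0 0 = Tm (chartH T) (chartK T) 0 0.
  rewrite e00 D1E /chartH.
  have -> : T 0 0 = wt_plus T ^+ 2 - wt_minus T ^+ 2 by rewrite pE mE; field.
  by move: sn; rewrite /wt_sum => sn; field.
apply: T_Lambda_inj => //.
- exact: Tm_T_Lambda.
- by rewrite e01 divr_gt0 ?sqrtD2_gt0 ?D1_gt0.
- have := first_sq_Tm (chartK T) h1; rewrite {1}/first_sq -a1 D1E => E.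
  suff -> : T 0 1 ^+ 2 = first_sq T - T 0 0 ^+ 2.
    suff -> : first_sq T = (2 + 2 * chartH T ^+ 2) / (4 / wt_sum T ^+ 2).
      by rewrite -E addrC addKr.
    have -> : first_sq T = wt_plus T ^+ 2 + wt_minus T ^+ 2 by rewrite pE mE; field.
    by rewrite /chartH; move: sn; rewrite /wt_sum => sn; field.
  by rewrite /first_sq addrC addKr.
- have pr := last_product_Tm (chartK T) h1; have wp := wt_prod_Tm_gt0 (chartK T) h1.
  have b0' : 0 < Tm (chartH T) (chartK T) 0 1 by rewrite e01 divr_gt0 ?sqrtD2_gt0 ?D1_gt0.
  rewrite e12 /chartK.
  have -> : T 1 2 * (2 * (1 - chartH T ^+ 2) * (2 * T 0 1 * T 1 2 / (wt_last T * wt_sum T)) *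
      sqrtD1 (chartH T) (2 * T 0 1 * T 1 2 / (wt_last T * wt_sum T)) /
      D2 (chartH T) (2 * T 0 1 * T 1 2 / (wt_last T * wt_sum T))) =
    T 1 2 ^+ 2 * (4 * (1 - chartH T ^+ 2) * (T 0 1 / (wt_last T * wt_sum T)) *
      sqrtD1 (chartH T) (chartK T) / D2 (chartH T) (chartK T)) by rewrite /chartK; ring.
  apply: mulr_ge0; first exact: sqr_ge0.
  apply: divr_ge0; last exact/ltW/D2_gt0.
  apply: mulr_ge0; last exact/ltW/sqrtD1_gt0.
  by apply: mulr_ge0; [rewrite mulr_ge0// ltW// one_sub_sq_gt0|rewrite divr_ge0// ltW].
Qed.

Lemma Tm_T_X : Tm 0 0 = T_X R.
Proof.
have d1 : D1 0 0 = 2 :> R by rewrite /D1 expr0n /= mulr0 !addr0.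
have d2 : D2 0 0 = 4 :> R by rewrite /D2 expr0n /= mulr0 mul0r !addr0 subr0 expr1n mulr1.
have s : sqrtD2 0 0 = 2 :> R.
  by rewrite /sqrtD2 d2 (_ : 4 = 2 ^+ 2) ?sqrtr_sqr ?ger0_norm//; ring.
apply/matrixP => i j; rewrite !mxE d1 d2 s.
by elim/ord3P: i; elim/ord3P: j => /=; rewrite ?mulr1n ?mulr0n; field.
Qed.

End Chart.

(** * Bounds for the Hausdorff dimension *)

Section HausdorffBounds.
Variables (R : realType) (M : Type) (dist : M -> M -> R).
Hypothesis dist_ge0 : forall p q, 0 <= dist p q.
Implicit Types (d e c : R) (A X : set M).

Lemma diam_le A e : (forall p q, A p -> A q -> dist p q <= e) -> (diam dist A <= e%:E)%E.
Proof.
by move=> H; apply: ge_ereal_sup => _ [[p q] [/= Ap Aq] <-]; rewrite lee_fin; exact: H.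
Qed.

Lemma diam_ub A p q : A p -> A q -> ((dist p q)%:E <= diam dist A)%E.
Proof. by move=> Ap Aq; apply: ereal_sup_ubound; exists (p, q). Qed.

Lemma hausdorff_weight_ge0 d A : (0 <= hausdorff_weight dist d A)%E.
Proof. by rewrite /hausdorff_weight; case: ifP => // _; exact: poweR_ge0. Qed.

Lemma hausdorff_weight_le d e A : 0 <= d ->
  (forall p q, A p -> A q -> dist p q <= e) ->
  (hausdorff_weight dist d A <= (e `^ d)%:E)%E.
Proof.
move=> d0 Ae; rewrite /hausdorff_weight; case: ifPn => [_|/set0P[p Ap]].
  by rewrite lee_fin powR_ge0.
have e0 : 0 <= e := le_trans (dist_ge0 p p) (Ae p p Ap Ap).
rewrite -poweR_EFin; apply: gt0_ler_poweR => //; last exact: diam_le.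
  rewrite in_itv /= leey andbT; apply: le_trans (diam_ub Ap Ap).
  by rewrite lee_fin.
by rewrite in_itv /= leey andbT lee_fin.
Qed.

Lemma hausdorff_content_ge0 d e A : (0 <= hausdorff_content dist d e A)%E.
Proof.
apply: le_ereal_inf_tmp => _ [F _ <-].
by apply: nneseries_ge0 => n _ _; exact: hausdorff_weight_ge0.
Qed.

(** The finite cover is continued by empty sets, which weigh 0 even for d = 0, so at most #|I| terms
    of the series count. *)
Lemma hausdorff_content_cover (I : finType) (S : I -> set M) X d e delta :
    0 <= d -> 0 <= e -> e <= delta ->
    (forall p, X p -> exists i, S i p) ->
    (forall i p q, S i p -> S i q -> dist p q <= e) ->
  (hausdorff_content dist d delta X <= (#|I|%:R * e `^ d)%:E)%E.
Proof.
move=> d0 e0 ed cov Se.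
pose F k := nth set0 [seq S i | i <- enum I] k.
have szF : size [seq S i | i <- enum I] = #|I| by rewrite size_map -cardE.
have FP k : F k = set0 \/ exists i, F k = S i.
  have [kI|kI] := ltnP k #|I|; last by left; rewrite /F nth_default// szF.
  have : F k \in [seq S i | i <- enum I] by rewrite mem_nth// szF.
  by case/mapP => i _ ->; right; exists i.
have Fe k p q : F k p -> F k q -> dist p q <= e.
  by case: (FP k) => [->//|[i ->]]; exact: Se.
apply: (@le_trans _ _ (\sum_(0 <= k <oo) hausdorff_weight dist d (F k))%E).
  apply: ereal_inf_lbound; exists F => //; split.
    move=> p /cov [i Sp]; exists (enum_rank i) => //.
    rewrite /F (nth_map i) ?nth_enum_rank// -cardE; exact: ltn_ord.
  by move=> k; apply: diam_le => p q Fp Fq; exact: le_trans (Fe k p q Fp Fq) ed.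
apply: lime_le; first by apply: is_cvg_nneseries => n _ _; exact: hausdorff_weight_ge0.
apply: nearW => n.
apply: (@le_trans _ _ (\sum_(0 <= k < n) (if (k < #|I|)%N then e `^ d else 0)%:E)%E).
  apply: lee_sum => k _; case: ltnP => kI; first exact: hausdorff_weight_le d0 (Fe k).
  by rewrite /F nth_default ?szF// /hausdorff_weight eqxx.
rewrite sumEFin lee_fin -big_mkcond /= big_const_seq iter_addr_0 -[leLHS]mulr_natl.
rewrite ler_wpM2r ?powR_ge0// ler_nat.
(* Counting up to [maxn n #|I|] treats both orders of n and #|I| at once: indices from #|I| on
   contribute nothing. *)
rewrite (leq_trans (_ : _ <= count (fun k => k < #|I|)%N (iota 0 (maxn n #|I|)))%N)//.
  by rewrite /index_iota subn0 (_ : maxn n #|I| = n + (#|I| - n))%N ?maxnE// iotaD count_cat leq_addr.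
rewrite (_ : maxn n #|I| = #|I| + (n - #|I|))%N; last by rewrite maxnC maxnE.
rewrite iotaD count_cat add0n [X in (_ + X)%N](_ : _ = 0%N).
  by rewrite addn0 (leq_trans (count_size _ _))// size_iota.
apply/eqP; rewrite -leqn0 leqNgt -has_count; apply/hasPn => k.
by rewrite mem_iota => /andP[kI _]; rewrite -leqNgt.
Qed.

Lemma hausdorff_measure_eq0 d X : 0 <= d ->
    (forall eps delta : R, 0 < eps -> 0 < delta ->
      exists (I : finType) (S : I -> set M) e,
       [/\ 0 <= e, e <= delta, #|I|%:R * e `^ d <= eps,
           forall p, X p -> exists i, S i p
         & forall i p q, S i p -> S i q -> dist p q <= e]) ->
  hausdorff_measure dist d X = 0%E.
Proof.
move=> d0 H; apply/eqP; rewrite eq_le; apply/andP; split.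
  apply: ge_ereal_sup => _ [delta /= delta0 <-]; apply/lee_addgt0Pr => eps eps0.
  have [I [S [e [e0 ed Ie cov Se]]]] := H eps delta eps0 delta0.
  apply: le_trans (hausdorff_content_cover d0 e0 ed cov Se) _.
  by rewrite add0e lee_fin.
apply: (le_trans (hausdorff_content_ge0 d 1 X)).
by apply: ereal_sup_ubound; exists 1 => //=.
Qed.

(** The images under f of a cover by sets of diameter at most 1 cover [0, c], so their lengths sum
    to at least c by Lebesgue measure. Each length is at most the diameter, hence at most its d-th
    power as d <= 1. *)
Lemma hausdorff_measure_neq0 (f : M -> R) d c X : 0 <= d -> d <= 1 -> 0 < c ->
    (forall p q, `|f p - f q| <= dist p q) ->
    (forall y, 0 <= y <= c -> exists2 p, X p & f p = y) ->
  hausdorff_measure dist d X <> 0%E.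
Proof.
move=> d0 d1 c0 flip fX.
suff : (c%:E <= hausdorff_measure dist d X)%E.
  by move=> /[swap] ->; rewrite lee_fin leNgt c0.
apply: (@le_trans _ _ (hausdorff_content dist d 1 X)); last first.
  by apply: ereal_sup_ubound; exists 1 => //=.
apply: le_ereal_inf_tmp => _ [F [XF Fd] <-].
(* The sets [F k] are arbitrary and their images may fail to be measurable, so each image is
   replaced by its closed interval hull. *)
pose J k : set R := if F k == set0 then set0 else
  `[inf (f @` F k), sup (f @` F k)]%classic.
have mJ k : measurable (J k) by rewrite /J; case: ifP.
have FJ k p : F k p -> [/\ has_sup (f @` F k), has_inf (f @` F k) & J k (f p)].
  move=> Fp; have d1' q : F k q -> `|f p - f q| <= 1.
    move=> Fq; apply: le_trans (flip _ _) _.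
    by rewrite -lee_fin; apply: le_trans (diam_ub Fp Fq) (Fd k).
  have hs : has_sup (f @` F k).
    split; first by exists (f p), p.
    by exists (f p + 1) => _ [q Fq <-]; have := d1' q Fq; rewrite ler_norml; lra.
  have hi : has_inf (f @` F k).
    split; first by exists (f p), p.
    by exists (f p - 1) => _ [q Fq <-]; have := d1' q Fq; rewrite ler_norml; lra.
  split=> //; rewrite /J ifF; last by apply/negbTE/set0P; exists p.
  rewrite /= in_itv /=; apply/andP; split.
    by apply: ge_inf; [exact: hi.2|exists p].
  by apply: ub_le_sup; [exact: hs.2|exists p].
have cJ : `[0, c]%classic `<=` \bigcup_k J k.
  move=> y; rewrite /= in_itv /= => /fX[p Xp <-].
  by have [k _ Fp] := XF p Xp; exists k => //; have [] := FJ k p Fp.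
have sub : (lebesgue_measure (`[0%R, c]%classic : set R) <=
    \sum_(0 <= k <oo) lebesgue_measure (J k))%E.
  exact: (@measure_sigma_subadditive _ _ _ (@lebesgue_measure R) _ J
    (fun k => mJ k) (measurable_itv _) cJ).
move: sub; rewrite lebesgue_measure_itv/= lte_fin c0 oppr0 adde0 => /le_trans; apply.
apply: lee_nneseries => // k _.
rewrite /J /hausdorff_weight; case: ifPn => [_|/set0P[p Fp]]; first by rewrite measure0.
have [hs hi _] := FJ k p Fp.
rewrite lebesgue_measure_itv/=; case: ifPn => [lt|_]; last exact: poweR_ge0.
have dk0 : (0 <= diam dist (F k))%E.
  by apply: le_trans (diam_ub Fp Fp); rewrite lee_fin.
have dk1 := Fd k.
have dfin : diam dist (F k) \is a fin_num.
  by rewrite ge0_fin_numE// (le_lt_trans dk1)// ltry.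
rewrite -(fineK dfin) poweR_EFin -EFinB lee_fin.
set D := fine _.
have D1' : D <= 1 by rewrite -lee_fin fineK.
have HD q q' : F k q -> F k q' -> f q - f q' <= D.
  move=> Fq Fq'; apply: le_trans (ler_norm _) _; apply: le_trans (flip _ _) _.
  by rewrite -lee_fin fineK//; exact: diam_ub.
have sD : sup (f @` F k) - inf (f @` F k) <= D.
  rewrite lerBlDr addrC -lerBlDr; apply: lb_le_inf; first exact: hi.1.
  move=> _ [q Fq <-]; rewrite lerBlDr; apply: ge_sup; first exact: hs.1.
  by move=> _ [q' Fq' <-]; have := HD q' q Fq' Fq; lra.
apply: le_trans sD _.
have [->|Dn] := eqVneq D 0; first exact: powR_ge0.
have D0 : 0 < D by rewrite lt_neqAle eq_sym Dn fine_ge0.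
rewrite -{1}(powRr1 (ltW D0)); apply: ger_powR => //.
by rewrite D0 D1'.
Qed.

Lemma hausdorff_dim_eq1 X :
    (forall d, 1 < d -> hausdorff_measure dist d X = 0%E) ->
    (forall d, 0 <= d -> d <= 1 -> hausdorff_measure dist d X <> 0%E) ->
  hausdorff_dim dist X = 1%E.
Proof.
move=> up low; apply/eqP; rewrite eq_le; apply/andP; split.
  apply/lee_addgt0Pr => eps eps0; apply: ereal_inf_lbound.
  exists (1 + eps) => //; split; first by lra.
  by apply: up; lra.
apply: le_ereal_inf_tmp => _ [d [d0 dX] <-]; rewrite lee_fin leNgt; apply/negP => d1.
exact: low (ltW d1) dX.
Qed.

End HausdorffBounds.

(** * Lipschitz estimates *)

Section TmLipschitz.
Variable R : realType.
Implicit Types (f g : R * R -> R) (p q : R * R) (c m L : R).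

Definition dist1 p q : R := `|p.1 - q.1| + `|p.2 - q.2|.

(* Bounded and Lipschitz on the box; the bound makes this stable under products. *)
Definition box_lipschitz f : Prop := exists2 L, 0 <= L & forall p q, in_box p -> in_box q ->
  `|f p| <= L /\ `|f p - f q| <= L * dist1 p q.

Lemma dist1_ge0 p q : 0 <= dist1 p q.
Proof. by rewrite addr_ge0. Qed.

Lemma box_lipschitz_cst c : box_lipschitz (fun=> c).
Proof.
exists `|c| => // p q _ _; split=> //.
by rewrite subrr normr0 mulr_ge0// dist1_ge0.
Qed.

Lemma in_box_le1 p : in_box p -> `|p.1| <= 1 /\ `|p.2| <= 1.
Proof. by move=> /in_box_tenth[]; lra. Qed.

Lemma box_lipschitz_fst : box_lipschitz (fun p => p.1).
Proof.
exists 1 => // p q pb _; split; first by have [] := in_box_le1 pb.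
by rewrite mul1r lerDl.
Qed.

Lemma box_lipschitz_snd : box_lipschitz (fun p => p.2).
Proof.
exists 1 => // p q pb _; split; first by have [] := in_box_le1 pb.
by rewrite mul1r lerDr.
Qed.

Lemma box_lipschitzD f g : box_lipschitz f -> box_lipschitz g ->
  box_lipschitz (fun p => f p + g p).
Proof.
move=> [L L0 fL] [K K0 gK]; exists (L + K); first exact: addr_ge0.
move=> p q pb qb; have [f1 f2] := fL p q pb qb; have [g1 g2] := gK p q pb qb.
split; first exact: le_trans (ler_normD _ _) (lerD f1 g1).
rewrite opprD addrACA mulrDl; exact: le_trans (ler_normD _ _) (lerD f2 g2).
Qed.

Lemma box_lipschitzM f g : box_lipschitz f -> box_lipschitz g ->
  box_lipschitz (fun p => f p * g p).
Proof.
move=> [L L0 fL] [K K0 gK]; exists (2 * (L * K)); first by rewrite !mulr_ge0.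
move=> p q pb qb; have [f1 f2] := fL p q pb qb; have [g1 g2] := gK p q pb qb.
have [f3 _] := fL q p qb pb; have LK := mulr_ge0 L0 K0.
split.
  rewrite normrM; apply: le_trans (ler_pM _ _ f1 g1) _ => //.
  by rewrite ler_peMl//; lra.
have -> : f p * g p - f q * g q = (f p - f q) * g p + f q * (g p - g q) by ring.
apply: le_trans (ler_normD _ _) _; rewrite !normrM.
have e1 := ler_pM (normr_ge0 _) (normr_ge0 _) f2 g1.
have e2 := ler_pM (normr_ge0 _) (normr_ge0 _) f3 g2.
apply: le_trans (lerD e1 e2) _.
by have -> : L * dist1 p q * K + L * (K * dist1 p q) = 2 * (L * K) * dist1 p q by ring.
Qed.

Lemma box_lipschitzN f : box_lipschitz f -> box_lipschitz (fun p => - f p).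
Proof.
move=> [L L0 fL]; exists L => // p q pb qb; have [f1 f2] := fL p q pb qb.
by rewrite normrN -opprD normrN.
Qed.

Lemma box_lipschitzV f m : 0 < m -> (forall p, in_box p -> m <= f p) ->
  box_lipschitz f -> box_lipschitz (fun p => (f p)^-1).
Proof.
move=> m0 fm [L L0 fL]; exists (m^-1 + m^-1 * m^-1 * L).
  by rewrite addr_ge0 ?mulr_ge0 ?invr_ge0// ltW.
move=> p q pb qb; have [_ f2] := fL p q pb qb.
have fp := fm p pb; have fq := fm q qb.
have fp0 := lt_le_trans m0 fp; have fq0 := lt_le_trans m0 fq.
have ip : (f p)^-1 <= m^-1 by rewrite lef_pV2.
have iq : (f q)^-1 <= m^-1 by rewrite lef_pV2.
have im0 : 0 <= m^-1 by rewrite invr_ge0 ltW.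
have ip0 : 0 <= (f p)^-1 by rewrite invr_ge0 ltW.
have iq0 : 0 <= (f q)^-1 by rewrite invr_ge0 ltW.
split; first by rewrite ger0_norm// (le_trans ip)// lerDl !mulr_ge0.
have -> : (f p)^-1 - (f q)^-1 = - ((f p)^-1 * (f q)^-1 * (f p - f q)).
  by field; rewrite !gt_eqF.
rewrite normrN !normrM (ger0_norm ip0) (ger0_norm iq0) mulrDl.
apply: ler_wpDl; first by rewrite mulr_ge0// dist1_ge0.
rewrite -mulrA -[leRHS]mulrA -[leRHS]mulrA.
by rewrite ler_pM ?mulr_ge0// ler_pM.
Qed.

Lemma box_lipschitz_sqrt f : (forall p, in_box p -> 1 <= f p) ->
  box_lipschitz f -> box_lipschitz (fun p => Num.sqrt (f p)).
Proof.
move=> fm [L L0 fL]; exists L => // p q pb qb; have [f1 f2] := fL p q pb qb.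
have fp := fm p pb; have fq := fm q qb.
have sp : 1 <= Num.sqrt (f p) by rewrite -[1]sqrtr1 ler_wsqrtr.
have sq : 1 <= Num.sqrt (f q) by rewrite -[1]sqrtr1 ler_wsqrtr.
have Ep : Num.sqrt (f p) ^+ 2 = f p by rewrite sqr_sqrtr//; lra.
have Eq : Num.sqrt (f q) ^+ 2 = f q by rewrite sqr_sqrtr//; lra.
rewrite ger0_norm ?sqrtr_ge0//; split.
  apply: le_trans f1; rewrite ger0_norm; last by lra.
  by rewrite -[leRHS]Ep expr2 ler_peMl// sqrtr_ge0.
apply: le_trans f2; rewrite -[f p in leRHS]Ep -[f q in leRHS]Eq subr_sqr normrM.
by rewrite ler_peMr// ger0_norm; lra.
Qed.

Lemma box_D1_bounds p : in_box p -> 2 <= D1 p.1 p.2 <= 2 + 1 / 10.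
Proof.
move=> pb; rewrite D1_ge2 /=; have [a b] := in_box_tenth pb; rewrite /D1.
rewrite -[p.1 ^+ 2]real_normK ?num_real// -[p.2 ^+ 2]real_normK ?num_real//.
have := normr_ge0 p.1; have := normr_ge0 p.2; clear - a b; rewrite !expr2.
by move: `|p.1| `|p.2| a b => x y *; nra.
Qed.

Lemma box_D2_bounds p : in_box p -> 4 - 1 / 10 <= D2 p.1 p.2 <= 4 + 1 / 10.
Proof.
move=> pb; have [a b] := in_box_tenth pb; rewrite /D2.
rewrite -[p.1 ^+ 2]real_normK ?num_real// -[p.2 ^+ 2]real_normK ?num_real//.
have a2 : 0 <= `|p.1| ^+ 2 <= 1 / 100.
  rewrite sqr_ge0 /=; have := ler_pM (normr_ge0 _) (normr_ge0 _) a a.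
  by rewrite -expr2; clear; lra.
have b2 : 0 <= `|p.2| ^+ 2 <= 1 / 100.
  rewrite sqr_ge0 /=; have := ler_pM (normr_ge0 _) (normr_ge0 _) b b.
  by rewrite -expr2; clear; lra.
move: (`|p.1| ^+ 2) (`|p.2| ^+ 2) a2 b2 => x y; clear => /andP[x0 x1] /andP[y0 y1].
by rewrite [_ ^+ 2]expr2; apply/andP; split; nra.
Qed.

Lemma box_lipschitz_D1 : box_lipschitz (fun p => D1 p.1 p.2).
Proof.
have L1 := box_lipschitz_fst; have L2 := box_lipschitz_snd.
exact: box_lipschitzD (box_lipschitzD (box_lipschitz_cst 2)
  (box_lipschitzM (box_lipschitz_cst 2) (box_lipschitzM L1 L1))) (box_lipschitzM L2 L2).
Qed.

Lemma box_lipschitz_1sq : box_lipschitz (fun p => 1 - p.1 ^+ 2).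
Proof.
have L1 := box_lipschitz_fst.
exact: box_lipschitzD (box_lipschitz_cst 1) (box_lipschitzN (box_lipschitzM L1 L1)).
Qed.

Lemma box_lipschitz_D2 : box_lipschitz (fun p => D2 p.1 p.2).
Proof.
have L1 := box_lipschitz_fst; have L2 := box_lipschitz_snd.
exact: box_lipschitzD (box_lipschitzM (box_lipschitz_cst 4)
  (box_lipschitzM box_lipschitz_1sq box_lipschitz_1sq))
  (box_lipschitzM (box_lipschitzM L2 L2) (box_lipschitzD (box_lipschitz_cst 2)
  (box_lipschitzM (box_lipschitz_cst 2) (box_lipschitzM L1 L1)))).
Qed.

Lemma box_lipschitz_entry i j : box_lipschitz (fun p => Tm p.1 p.2 i j).
Proof.
have L1 := box_lipschitz_fst; have L2 := box_lipschitz_snd.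
have b1 p : in_box p -> 2 <= D1 p.1 p.2 by move/box_D1_bounds/andP => [].
have b2 p : in_box p -> 3 <= D2 p.1 p.2 by move/box_D2_bounds; lra.
have i1 := box_lipschitzV (ltr0n R 2) b1 box_lipschitz_D1.
have i2 := box_lipschitzV (ltr0n R 3) b2 box_lipschitz_D2.
have r1 : box_lipschitz (fun p => sqrtD1 p.1 p.2).
  by apply: box_lipschitz_sqrt box_lipschitz_D1 => p /b1; lra.
have r2 : box_lipschitz (fun p => sqrtD2 p.1 p.2).
  by apply: box_lipschitz_sqrt box_lipschitz_D2 => p /b2; lra.
have A1 := box_lipschitzM (box_lipschitzM (box_lipschitz_cst 4) L1) i1.
have A3 := box_lipschitzM (box_lipschitzN (box_lipschitzM
  (box_lipschitzM (box_lipschitz_cst 4) L1) (box_lipschitzM L2 L2))) i2.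
have B1 := box_lipschitzM r2 i1.
have B2 := box_lipschitzM (box_lipschitzM (box_lipschitzM
  (box_lipschitzM (box_lipschitz_cst 2) box_lipschitz_1sq) L2) r1) i2.
have A2 := box_lipschitzD (box_lipschitzN A1) (box_lipschitzN A3).
have A0 := box_lipschitz_cst 0.
have ext f g : f =1 g -> box_lipschitz f -> box_lipschitz g by move=> /funext ->.
elim/ord3P: i; elim/ord3P: j;
  first [ by apply: ext A0 => p; rewrite !mxE | by apply: ext A1 => p; rewrite !mxE
        | by apply: ext B1 => p; rewrite !mxE | by apply: ext B2 => p; rewrite !mxE
        | by apply: ext A3 => p; rewrite !mxE | by apply: ext A2 => p; rewrite !mxE ].
Qed.

(** There are nine entries, and 3 = sqrt 9. *)
Lemma frobenius_dist_le (A B : 'M[R]_3) m : 0 <= m ->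
  (forall i j, `|A i j - B i j| <= m) -> frobenius_dist A B <= 3 * m.
Proof.
move=> m0 H; have e i j : (A i j - B i j) ^+ 2 <= m ^+ 2.
  by rewrite -real_normK ?num_real// ler_sqr ?nnegrE.
rewrite /frobenius_dist; apply: (@le_trans _ _ (Num.sqrt ((3 * m) ^+ 2))).
  apply: ler_wsqrtr; rewrite !sum3E.
  have := (e 0 0, e 0 1, e 0 2, e 1 0, e 1 1, e 1 2, e 2 0, e 2 1, e 2 2).
  rewrite exprMn; move: (m ^+ 2) {e H} => x.
  by case=> [[[[[[[[? ?] ?] ?] ?] ?] ?] ?] ?]; lra.
by rewrite sqrtr_sqr ger0_norm// mulr_ge0.
Qed.

Lemma frobenius_dist_ge0 (A B : 'M[R]_3) : 0 <= frobenius_dist A B.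
Proof. exact: sqrtr_ge0. Qed.

Lemma frobenius_dist_entry (A B : 'M[R]_3) i j : `|A i j - B i j| <= frobenius_dist A B.
Proof.
rewrite -sqrtr_sqr; apply: ler_wsqrtr; rewrite (bigD1 i)//= (bigD1 j)//= -addrA lerDl.
apply: addr_ge0; first by apply: sumr_ge0 => l _; exact: sqr_ge0.
by apply: sumr_ge0 => l _; apply: sumr_ge0 => l' _; exact: sqr_ge0.
Qed.

Lemma Tm_lipschitz : exists2 L, 0 <= L & forall p q, in_box p -> in_box q ->
  frobenius_dist (Tm p.1 p.2) (Tm q.1 q.2) <= L * dist1 p q.
Proof.
have H i j := box_lipschitz_entry i j.
have [F HF] : exists F : 'I_3 -> 'I_3 -> R, forall i j, 0 <= F i j /\
    forall p q, in_box p -> in_box q ->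
    `|Tm p.1 p.2 i j - Tm q.1 q.2 i j| <= F i j * dist1 p q.
  exists (fun i j => projT1 (cid2 (H i j))) => i j; case: cid2 => L L0 HL /=.
  by split=> // p q pb qb; exact: (HL p q pb qb).2.
have F0 i j := (HF i j).1.
exists (3 * \sum_i \sum_j F i j).
  by rewrite mulr_ge0//; apply: sumr_ge0 => i _; apply: sumr_ge0 => j _.
move=> p q pb qb; rewrite -mulrA; apply: frobenius_dist_le.
  rewrite mulr_ge0 ?dist1_ge0//; apply: sumr_ge0 => i _; exact: sumr_ge0.
move=> i j; apply: le_trans ((HF i j).2 p q pb qb) _.
rewrite ler_wpM2r ?dist1_ge0// (bigD1 i)//= (bigD1 j)//= -addrA lerDl.
apply: addr_ge0; first exact: sumr_ge0.
by apply: sumr_ge0 => l _; exact: sumr_ge0.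
Qed.

Lemma bernoulli (x : R) n : 0 <= x -> n%:R * x <= (1 + x) ^+ n.
Proof.
move=> x0; suff : 1 + n%:R * x <= (1 + x) ^+ n by lra.
elim: n => [|n IH]; first by rewrite mul0r addr0 expr0.
rewrite exprS mulrDl mul1r -natr1 mulrDl mul1r addrA; apply: lerD => //.
rewrite ler_peMr//; apply: exprn_ege1; lra.
Qed.

(** With N = 2^n and q = s^2, one factor s^N keeps N s^N bounded by Bernoulli's inequality, and the
    other tends to 0. *)
Lemma dyadic_decay (q eps : R) : 0 < q -> q < 1 -> 0 < eps ->
  \forall n \near \oo, (2 ^ n)%:R * q ^+ (2 ^ n) <= eps.
Proof.
move=> q0 sqrtD1 eps0; set s := Num.sqrt q.
have s0 : 0 < s by rewrite sqrtr_gt0.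
have qE : q = s ^+ 2 by rewrite sqr_sqrtr// ltW.
have s1 : s < 1 by rewrite -(@ltr_pXn2r _ 2) ?nnegrE ?ltW// -qE expr1n.
set x := s^-1 - 1; have x0 : 0 < x by rewrite subr_gt0 invf_gt1.
have : s ^+ n @[n --> \oo] --> (0 : R) by apply: cvg_expr; rewrite gtr0_norm.
move=> /cvgr0Pnorm_le /(_ (x * eps) (mulr_gt0 x0 eps0)); apply: filterS => n.
rewrite ger0_norm ?exprn_ge0 ?(ltW s0)// => sn.
have sN : s ^+ (2 ^ n) <= x * eps.
  by apply: le_trans sn; apply: ler_wiXn2l; [exact: ltW|exact: ltW|exact/ltnW/ltn_expl].
have B : (2 ^ n)%:R * s ^+ (2 ^ n) <= x^-1.
  have := bernoulli (2 ^ n) (ltW x0).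
  have -> : 1 + x = s^-1 by rewrite /x; ring.
  by rewrite exprVn -ler_pdivlMr// -ler_pdivlMr ?exprn_gt0// mulrC.
rewrite qE exprAC expr2 mulrA.
apply: le_trans (ler_pM _ _ B sN) _; rewrite ?mulr_ge0 ?exprn_ge0 ?(ltW s0)//.
by rewrite mulKf// gt_eqF.
Qed.

End TmLipschitz.

(** * The set of initial conditions converging to T_X *)

Section Conclusion.
Variable R : realType.
Implicit Types (p q : R * R) (h k c C d : R) (T : 'M[R]_3) (sigma tau : sign_seq) (n : nat).
Local Notation W := (@wilkinson R).

Definition nbhd : set 'M[R]_3 := @chartV R `&` @T_Lambda R.

Lemma nbhdP T : nbhd T <-> exists2 p, in_box p & T = Tm p.1 p.2.
Proof.
split=> [[V L]|[p pb ->]].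
  by have [b E] := chart_surj V L; exists (chartH T, chartK T).
by split; [exact: Tm_in_chartV|apply: Tm_T_Lambda; exact: in_box_lt1].
Qed.

Lemma iter_wilkinson p n : in_box p ->
  iter n W (Tm p.1 p.2) = Tm (iter n step p).1 (iter n step p).2.
Proof.
move=> pb; elim: n => //= n ->.
by rewrite wilkinson_Tm//; exact: iter_box.
Qed.

(** The ratio T_23 / k is 1 / sqrt 2 at T_X and stays within [1/2, 1] in the box, so rates for k
    become rates for T_23. *)
Lemma Tm12_bounds p : in_box p -> `|p.2| / 2 <= `|Tm p.1 p.2 1 2| <= `|p.2|.
Proof.
move=> pb; have h1 := in_box_lt1 pb.
have [_ _ -> _ _] := Tm_entries p.1 p.2.
have /andP[d1 d2] := box_D1_bounds pb; have /andP[e1 e2] := box_D2_bounds pb.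
have Q := sqrtD1_sq p.1 p.2; have Q0 := sqrtD1_gt0 p.1 p.2.
have ql : 7 / 5 <= sqrtD1 p.1 p.2 by rewrite -(@ler_pXn2r _ 2) ?nnegrE ?(ltW Q0)// ?Q; lra.
have qu : sqrtD1 p.1 p.2 <= 3 / 2 by rewrite -(@ler_pXn2r _ 2) ?nnegrE ?(ltW Q0)// Q; lra.
have hh : 99 / 100 <= 1 - p.1 ^+ 2 <= 1.
  have [a _] := in_box_tenth pb.
  have := ler_pM (normr_ge0 _) (normr_ge0 _) a a; rewrite -expr2 real_normK ?num_real//.
  by have := sqr_ge0 p.1; clear; lra.
have D0 : 0 < D2 p.1 p.2 by lra.
set t := 2 * (1 - p.1 ^+ 2) * sqrtD1 p.1 p.2 / D2 p.1 p.2.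
have -> : 2 * (1 - p.1 ^+ 2) * p.2 * sqrtD1 p.1 p.2 / D2 p.1 p.2 = t * p.2.
  by rewrite /t; ring.
have hq : 99 / 100 * (7 / 5) <= (1 - p.1 ^+ 2) * sqrtD1 p.1 p.2 <= 3 / 2.
  case/andP: hh => h2 h3; apply/andP; split.
    by apply: ler_pM => //; lra.
  by rewrite -[leRHS]mul1r; apply: ler_pM => //; [lra|exact: ltW].
have t2 : 1 / 2 <= t <= 1.
  by rewrite /t (ler_pdivlMr _ _ D0) (ler_pdivrMr _ _ D0) -mulrA; clear - hq e1 e2; lra.
have k0 := normr_ge0 p.2; rewrite normrM ger0_norm; last by clear - t2; lra.
by case/andP: t2 => t2 t3; apply/andP; split;
  [have := ler_wpM2r k0 t2; lra|rewrite ler_piMl].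
Qed.

Lemma rate_transfer (r : nat) (x y : nat -> R) c C : 0 < c -> 0 < C ->
    (forall n, c * `|x n| ^+ r <= `|x n.+1| <= C * `|x n| ^+ r) ->
    x @ \oo --> (0 : R) -> (forall n, `|x n| / 2 <= `|y n| <= `|x n|) ->
  strict_rate r y.
Proof.
move=> c0 C0 xr x0 yx; split.
  apply/norm_cvg0P; apply: (@squeeze_cvgr _ _ _ _ (fun=> 0) (fun n => `|x n|)).
  - by apply: nearW => n; rewrite normr_ge0 /=; have /andP[] := yx n.
  - exact: cvg_cst.
  - exact/norm_cvg0P.
exists (c / 2), (C * 2 ^+ r); split.
- by rewrite divr_gt0.
- by rewrite mulr_gt0// exprn_gt0.
move=> n; have /andP[x1 x2] := xr n; have /andP[y1 y2] := yx n.
have /andP[y3 y4] := yx n.+1; apply/andP; split.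
  apply: le_trans y3; rewrite mulrAC ler_pM2r ?invr_gt0//; apply: le_trans x1.
  by rewrite ler_pM2l// lerXn2r ?nnegrE.
apply: le_trans y4 _; apply: le_trans x2 _; rewrite -mulrA ler_pM2l// -exprMn.
by rewrite lerXn2r ?nnegrE// ?mulr_ge0//; lra.
Qed.

Lemma orbit_limit p : in_box p -> exists l,
  [/\ `|l| < 1, iter n W (Tm p.1 p.2) @[n --> \oo] --> Tm l 0,
    trapped p <-> l = 0 & forall n, `|(iter n step p).1 - l| <= `|(iter n step p).2|].
Proof.
move=> pb; have [l [xl H]] := orbit_cvg pb.
have l1 : `|l| < 1.
  have := H 0%N; case: pb => /= a b; have := @radiusE R; have := ler_distD p.1 l 0.
  by rewrite !subr0 distrC; clear - a b; lra.
exists l; split=> //.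
- have -> : (fun n => iter n W (Tm p.1 p.2)) =
      (fun n => Tm (iter n step p).1 (iter n step p).2).
    by apply/funext => n; exact: iter_wilkinson.
  exact: Tm_cvg l1 xl (iter_k_cvg pb).
- split=> [/(trappedP pb) x0|l0]; first by apply: cvg_unique xl x0; exact: Rhausdorff.
  by apply/(trappedP pb); rewrite -l0.
Qed.

Lemma Tm_l0_eq l : `|l| < 1 -> Tm l 0 = @T_X R -> l = 0.
Proof.
move=> l1 E; rewrite -(chartH_Tm 0 l1) E -(Tm_T_X R) chartH_Tm//.
by rewrite normr0.
Qed.

Lemma wilkinson_rates T0 : nbhd T0 -> exists Tinf : 'M[R]_3,
  [/\ iter n W T0 @[n --> \oo] --> Tinf, Tinf 1 2 = 0,
      Tinf = @T_X R -> strict_rate 2 (fun n => iter n W T0 1 2)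
    & Tinf <> @T_X R -> strict_rate 3 (fun n => iter n W T0 1 2)].
Proof.
move=> /nbhdP[p pb ->]; have [l [l1 Tl tr H]] := orbit_limit pb.
have yx n : `|(iter n step p).2| / 2 <= `|iter n W (Tm p.1 p.2) 1 2| <= `|(iter n step p).2|.
  by rewrite iter_wilkinson//; apply: Tm12_bounds; exact: iter_box.
exists (Tm l 0); split=> //.
- by have [_ _ -> _ _] := Tm_entries l 0; rewrite mulr0 !mul0r.
- move=> /(Tm_l0_eq l1)/tr pt.
  apply: (@rate_transfer _ (fun n => (iter n step p).2) _ (22 / 100) 1) => //.
  + move=> n /=; have nb := iter_box n pb; rewrite mul1r; apply/andP; split.
      exact: step_k_lower_quadratic nb (pt n).
    by have := step_k_bound nb; rewrite -[X in _ <= X]real_normK ?num_real.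
  + exact: iter_k_cvg.
- move=> lX; have l0 : l != 0 by apply/eqP => l0; apply: lX; rewrite l0 Tm_T_X.
  apply: (@rate_transfer _ (fun n => (iter n step p).2) _ 1 (4 / `|l|)) => //.
  + by rewrite divr_gt0// normr_gt0.
  + move=> n /=; have nb := iter_box n pb; rewrite mul1r step_k_lower_cubic//=.
    exact: step_k_upper_cubic.
  + exact: iter_k_cvg.
Qed.

Definition limit_X : set 'M[R]_3 :=
  [set T0 | nbhd T0 /\ iter n W T0 @[n --> \oo] --> @T_X R].

Lemma limit_XP T : limit_X T <-> exists p, [/\ in_box p, trapped p & T = Tm p.1 p.2].
Proof.
split=> [[/nbhdP[p pb ->] TX]|[p [pb pt ->]]].
  have [l [l1 Tl tr _]] := orbit_limit pb; exists p; split=> //.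
  by apply/tr/Tm_l0_eq => //; apply: cvg_unique Tl TX; exact: norm_hausdorff.
have [l [l1 Tl tr _]] := orbit_limit pb; split; first by apply/nbhdP; exists p.
by move: Tl; rewrite (tr.1 pt) Tm_T_X.
Qed.

(** The curve over k >= 0 and its mirror image have the same signs; glued at T_X they form one arc,
    with the signed k as a global parameter. *)
Definition arc_map sigma k : 'M[R]_3 := Tm (curve sigma `|k|) k.
Definition arc_dom : set R := [set k | `|k| < radius].
Definition arc sigma : set 'M[R]_3 := [set arc_map sigma k | k in arc_dom].

Lemma arc_box sigma k : `|k| < radius -> in_box (curve sigma `|k|, k).
Proof. by move=> kr; have [] := curve_box sigma (normr_ge0 k) kr. Qed.

Lemma arc_lt1 sigma k : `|k| < radius -> `|curve sigma `|k| | < 1.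
Proof. by move=> kr; exact: in_box_lt1 (arc_box sigma kr). Qed.

Lemma arc_map0 sigma : arc_map sigma 0 = @T_X R.
Proof. by rewrite /arc_map normr0 curve0 Tm_T_X. Qed.

Lemma step_k0 p : in_box p -> p.2 = 0 -> step p = p.
Proof.
move=> pb p0; have := step_drift pb; have := step_k_eq0 pb.
rewrite p0 eqxx => /eqP s2; rewrite s2 normr0 subrr normr_le0 subr_eq0 => /eqP s1.
by rewrite [LHS]surjective_pairing s1 s2 -p0 -surjective_pairing.
Qed.

Lemma arc_trapped sigma k : `|k| < radius -> trapped (curve sigma `|k|, k).
Proof.
move=> kr; have pb := arc_box sigma kr.
have [k0|kn] := eqVneq k 0.
  move=> n; have -> : iter n step (curve sigma `|k|, k) = (curve sigma `|k|, k).
    by elim: n => //= n ->; exact: step_k0.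
  by rewrite /= k0 normr0 curve0 normr0.
apply/(trapped_fold pb); apply: curve_trapped => //; by rewrite normr_gt0.
Qed.

Lemma arc_union : limit_X = \bigcup_(sigma in [set: sign_seq]) arc sigma.
Proof.
apply/seteqP; split=> T.
  move=> /limit_XP[p [pb pt ->]].
  have [p0|pn] := eqVneq p.2 0.
    (* A trapped point with k = 0 has h = 0 and is T_X, which lies on every arc; any sequence will
       do. *)
    exists (fun=> true) => //; exists 0; first by rewrite /arc_dom /= normr0 radius_gt0.
    have := pt 0%N; rewrite /= p0 normr0 normr_le0 => /eqP ->.
    by rewrite arc_map0 Tm_T_X.
  exists (fun n => 0 <= (iter n step p).1) => //; exists p.2; first by case: pb.
  by rewrite /arc_map -trapped_curve.
move=> [sigma _ [k kr <-]]; apply/limit_XP.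
by exists (curve sigma `|k|, k); split=> //; [exact: arc_box|exact: arc_trapped].
Qed.

(** The chart recovers (h, k) from the matrix, and for k nonzero the signs of h along the orbit
    recover the whole sequence. *)
Lemma arc_disjoint sigma tau : sigma <> tau -> arc sigma `&` arc tau = [set @T_X R].
Proof.
move=> st; apply/seteqP; split=> [T [[k kr <-] [c cr]]|T ->]; last first.
  by split; exists 0; rewrite ?arc_map0 // /arc_dom /= normr0 radius_gt0.
rewrite /arc_map => E.
have ck : c = k.
  by rewrite -(chartK_Tm c (arc_lt1 tau cr)) E chartK_Tm//; exact: arc_lt1.
rewrite /= ; have [k0|kn] := eqVneq k 0; first by rewrite k0 normr0 curve0 Tm_T_X.
case: st; apply/funext => n; rewrite ck in E.
have kp : 0 < `|k| by rewrite normr_gt0.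
have hE : curve sigma `|k| = curve tau `|k|.
  rewrite -(chartH_Tm k (arc_lt1 tau kr)) E chartH_Tm//; exact: arc_lt1.
by rewrite -(iter_curve_sign n sigma kp kr) hE iter_curve_sign.
Qed.

Lemma arc_wilkinson sigma : W @` arc sigma `<=` arc (sharp sigma).
Proof.
move=> _ [_ [k kr <-] <-]; have pb := arc_box sigma kr.
rewrite /arc_map (wilkinson_Tm pb).
have [k0|kn] := eqVneq k 0.
  rewrite step_k0// /= k0 normr0 curve0 Tm_T_X; exists 0; last exact: arc_map0.
  by rewrite /arc_dom /= normr0 radius_gt0.
have kp : 0 < `|k| by rewrite normr_gt0.
exists (step (curve sigma `|k|, k)).2; first by case: (step_box pb).
have := step_fold pb; rewrite /fold /= (step_curve sigma kp kr) => -[E1 E2].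
by rewrite /arc_map -E2 E1.
Qed.

Lemma arc_map_continuous sigma : {within arc_dom, continuous (arc_map sigma)}.
Proof.
apply/subspace_continuousP => k kr; apply: Tm_cvg; first exact: arc_lt1.
- apply/cvgrPdist_lt => e e0; rewrite near_withinE; near=> t => tr.
  apply: (@le_lt_trans _ _ (50 * `|k - t|)).
    apply: le_trans (curve_lipschitz _ _ _ _ _) _ => //.
    by rewrite ler_pM2l//; exact: ler_dist_dist.
  rewrite mulrC -ltr_pdivlMr//; near: t.
  by apply: cvgr_dist_lt => //; exact: divr_gt0.
- exact: cvg_within.
Unshelve. all: by end_near.
Qed.

Lemma arcK sigma k : arc_dom k -> chartK (arc_map sigma k) = k.
Proof. by move=> kr; rewrite chartK_Tm//; exact: arc_lt1. Qed.

Lemma arc_is_arc sigma : is_arc (arc sigma).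
Proof.
exists arc_dom, (arc_map sigma), (@chartK R); split.
- split.
    move=> x y xr yr z /andP[xz zy]; move: xr yr; rewrite /arc_dom /= !ltr_norml.
    by move=> /andP[x1 x2] /andP[y1 y2]; apply/andP; split; lra.
  exists 0, (@radius R / 2); have := radius_gt0 R; rewrite /arc_dom /= => r0.
  by split; rewrite ?normr0// ?ger0_norm; lra.
- split.
  + by move=> k kr; exists k.
  + move=> k c; rewrite !inE => kr cr E.
    by rewrite -(arcK sigma kr) E arcK.
  + by move=> _ [k kr <-]; exists k.
- by move=> k; rewrite inE => kr; exact: arcK.
- exact: arc_map_continuous.
- apply/subspace_continuousP => _ [k kr <-].
  by apply: cvg_within_filter; apply: chartK_cvg; exact: arc_lt1.
Qed.

(** One arc is enough: along it the entry T_23, which is 1-Lipschitz for the Frobenius distance,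
    vanishes at T_X and is positive further on, so it takes all values in between. *)
Lemma limit_X_measure_neq0 d : 0 <= d -> d <= 1 ->
  hausdorff_measure (@frobenius_dist R) d limit_X <> 0%E.
Proof.
move=> d0 d1; pose s0 : sign_seq := fun=> true.
have r0 := radius_gt0 R.
pose f k := arc_map s0 k 1 2.
have f0 : f 0 = 0 by rewrite /f arc_map0 !mxE /= addr0.
have rr : `|radius / 2| < radius :> R by rewrite ger0_norm; lra.
have fr : 0 < f (radius / 2).
  rewrite /f /arc_map; have [_ _ -> _ _] := Tm_entries (curve s0 `|radius / 2 : R|) (radius / 2).
  have h1 := arc_lt1 s0 rr.
  by rewrite divr_gt0 ?D2_gt0// !mulr_gt0 ?sqrtD1_gt0 ?one_sub_sq_gt0 ?invr_gt0.
have fc : {within `[0, radius / 2]%classic, continuous f}.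
  apply/subspace_continuousP => k; rewrite /= in_itv /= => /andP[k0 k1].
  have kr : arc_dom k by rewrite /arc_dom /= ger0_norm//; lra.
  have /subspace_continuousP /(_ k kr) H := @arc_map_continuous s0.
  have sub : `[0, radius / 2]%classic `<=` arc_dom.
    by move=> t; rewrite /= in_itv /= => /andP[t0 t1]; rewrite /arc_dom /= ger0_norm//; lra.
  have H' : arc_map s0 t @[t --> within `[0, radius / 2]%classic (nbhs k)] --> arc_map s0 k.
    exact: cvg_trans (cvg_app _ (within_subset _ sub)) H.
  exact: cvg_comp H' (@entry_cvg R 1 2 (arc_map s0 k)).
apply: (@hausdorff_measure_neq0 _ _ _ (@frobenius_dist_ge0 R) (fun T => T 1 2) d (f (radius / 2))) => //.
  by move=> A B; exact: frobenius_dist_entry.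
have r2 : 0 <= radius / 2 :> R by lra.
move=> y yf; have [|t tr <-] := @IVT R f 0 (radius / 2) y r2 fc.
  by rewrite f0 min_l ?max_r ?(ltW fr).
move: tr; rewrite in_itv /= => /andP[t0 t1].
exists (arc_map s0 t) => //; rewrite arc_union; exists s0 => //; exists t => //.
by rewrite /arc_dom /= ger0_norm//; lra.
Qed.

(** 53 = 50 + 2 + 1: slope and separation term of [trapped_sep] for h, then the difference in k
    itself. *)
Lemma cell_diam n p q : in_box p -> in_box q -> trapped p -> trapped q ->
    (forall j, (j < n)%N -> (0 <= (iter j step p).1) = (0 <= (iter j step q).1)) ->
    `|p.2 - q.2| <= (1 / 2) ^+ (2 ^ n) ->
  dist1 p q <= 53 * (1 / 2) ^+ (2 ^ n).
Proof.
move=> pb qb pt qt sgn pq; have := trapped_sep pb qb pt qt sgn.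
have := ler_dist_dist p.2 q.2; rewrite /dist1; clear - pq; lra.
Qed.

Lemma half_powR (d : R) (N : nat) :
  (((1 / 2) ^+ N) `^ d : R) = (1 / 2) ^+ N * ((1 / 2) `^ (d - 1)) ^+ N.
Proof.
have h0 : (0 : R) < 1 / 2 by lra.
have x0 : (0 : R) < (1 / 2) ^+ N by rewrite exprn_gt0.
have -> : ((1 / 2) ^+ N) `^ d = ((1 / 2) ^+ N) `^ 1 * ((1 / 2) ^+ N) `^ (d - 1) :> R.
  rewrite -powRD; last by apply/implyP => _; rewrite gt_eqF.
  by congr (_ `^ _); ring.
rewrite powRr1 ?(ltW x0)//; congr (_ * _).
by rewrite -[(1 / 2) ^+ N]powR_mulrn ?(ltW h0)// -powRrM (mulrC N%:R) powRrM powR_mulrn ?powR_ge0.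
Qed.

Lemma limit_X_measure_eq0 d : 1 < d ->
  hausdorff_measure (@frobenius_dist R) d limit_X = 0%E.
Proof.
move=> d1; apply: (hausdorff_measure_eq0 (@frobenius_dist_ge0 R)); first by lra.
move=> eps delta eps0 delta0; have [L L0 HL] := Tm_lipschitz R.
pose C := 53 * L; have C0 : 0 <= C by rewrite mulr_ge0.
pose q := (1 / 2 : R) `^ (d - 1).
have q0 : 0 < q by apply: powR_gt0; lra.
have sqrtD1 : q < 1.
  have one : 1 `^ (d - 1) = 1 :> R by rewrite powR1.
  rewrite -[ltRHS]one; apply: gt0_ltr_powR; rewrite ?nnegrE; lra.
(* The summand 1 keeps the divisor positive even if C = 0. *)
have K0 : 0 < 2 * C `^ d + 1 by rewrite ltr_wpDl// mulr_ge0// powR_ge0.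
have small : exists n, (2 ^ n)%:R * q ^+ (2 ^ n) <= eps / (2 * C `^ d + 1) /\
    C * (1 / 2) ^+ (2 ^ n) <= delta.
  have /cvgr0Pnorm_le H := half_cvg0 C.
  near \oo => n; exists n; split.
    by near: n; apply: dyadic_decay => //; exact: divr_gt0.
  apply: (@le_trans _ _ (C * (1 / 2) ^+ n)); first by rewrite ler_wpM2l// half_expn_le.
  apply: le_trans (ler_norm _) _; near: n; exact: H.
have [n [n1 n2]] := small.
(* The strip height e = 1 / M is the scale at which n common signs separate trapped points. There
   are 2^n * 2 M cells of diameter at most C e, and since e^d = e q^(2^n), the weighted count is 2
   C^d 2^n q^(2^n), which tends to 0. *)
pose M := (2 ^ (2 ^ n))%N; pose e : R := (1 / 2) ^+ (2 ^ n).
have e0 : 0 <= e by rewrite exprn_ge0//; lra.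
have Me : M%:R * e = 1.
  by rewrite /M /e natrX -exprMn (_ : 2%:R * (1 / 2) = 1 :> R) ?expr1n//; field.
have M0 : (0 : R) < M%:R by rewrite ltr0n expn_gt0.
(* A cell fixes the first n signs and a strip of k; as k + 1 lies in [0, 2), there are 2 M
   strips. *)
pose S (bj : n.-tuple bool * 'I_(2 * M)) : set 'M[R]_3 :=
  [set T | exists p, [/\ in_box p, trapped p, T = Tm p.1 p.2,
     forall i : 'I_n, (0 <= (iter i step p).1) = tnth bj.1 i &
     (bj.2 : nat)%:R <= (p.2 + 1) * M%:R < (bj.2 : nat).+1%:R]].
exists (n.-tuple bool * 'I_(2 * M))%type, S, (C * e); split.
- exact: mulr_ge0.
- exact: n2.
- rewrite card_prod card_tuple card_bool card_ord !natrM.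
  rewrite powRM// /e half_powR -/q -/e.
  have -> : (2 ^ n)%:R * (2%:R * M%:R) * (C `^ d * (e * q ^+ (2 ^ n))) =
     2 * C `^ d * (M%:R * e) * ((2 ^ n)%:R * q ^+ (2 ^ n)) by ring.
  rewrite Me mulr1; apply: (@le_trans _ _ ((2 * C `^ d + 1) * ((2 ^ n)%:R * q ^+ (2 ^ n)))).
    by rewrite ler_wpM2r ?lerDl// mulr_ge0// exprn_ge0// ltW.
  by rewrite mulrC -ler_pdivlMr.
- move=> T /limit_XP[p [pb pt ->]]; have [_ p2] := in_box_tenth pb.
  have x0 : 0 <= (p.2 + 1) * M%:R.
    by rewrite mulr_ge0//; move: p2; rewrite ler_norml; lra.
  have /andP[t1 t2] := truncn_itv x0.
  have tM : (Num.trunc ((p.2 + 1) * M%:R) < 2 * M)%N.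
    rewrite -(ltr_nat R); apply: le_lt_trans t1 _.
    by rewrite natrM ltr_pM2r//; move: p2; rewrite ler_norml; lra.
  exists ([tuple 0 <= (iter i step p).1 | i < n], Ordinal tM); exists p; split=> //.
    by move=> i; rewrite tnth_mktuple.
  by rewrite /= t1 t2.
- move=> [b j] _ _ [p [pb pt -> pS pM]] [p' [pb' pt' -> pS' pM']].
  apply: le_trans (HL p p' pb pb') _; rewrite /C -mulrA mulrCA ler_wpM2l//.
  apply: cell_diam => //.
    by move=> i i_n; rewrite (pS (Ordinal i_n)) (pS' (Ordinal i_n)).
  rewrite -(ler_pM2l M0) Me -[X in X * _](gtr0_norm M0) -normrM ler_norml.
  move: pM pM'; rewrite -!natr1 /=; clear; move: M%:R => x; lra.
Unshelve. all: by end_near.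
Qed.

End Conclusion.

Theorem theorem1p1 (R : realType) :
  exists U : set 'M[R]_3,
    (exists2 V : set 'M[R]_3, open V & U = V `&` @T_Lambda R) /\
    U (@T_X R) /\
    (* (a) *)
    (forall T, U T -> U (wilkinson T)) /\
    (* (b) *)
    (forall T0, U T0 ->
       exists Tinf : 'M[R]_3,
         [/\ iter k (@wilkinson R) T0 @[k --> \oo] --> Tinf,
             Tinf 1 2 = 0,
             Tinf = @T_X R ->
               strict_rate 2 (fun k => iter k (@wilkinson R) T0 1 2)
           & Tinf <> @T_X R ->
               strict_rate 3 (fun k => iter k (@wilkinson R) T0 1 2)]) /\
    let X : set 'M[R]_3 :=
      [set T0 | U T0 /\ iter k (@wilkinson R) T0 @[k --> \oo] --> @T_X R] in
    (* (c) *)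
    (exists Xs : sign_seq -> set 'M[R]_3,
       [/\ forall sigma, is_arc (Xs sigma),
           X = \bigcup_(sigma in [set: sign_seq]) Xs sigma,
           forall sigma tau, sigma <> tau ->
             Xs sigma `&` Xs tau = [set @T_X R]
         & forall sigma, @wilkinson R @` Xs sigma `<=` Xs (sharp sigma)]) /\
    (* (d) *)
    hausdorff_dim (@frobenius_dist R) X = 1%:E.
Proof.
exists (@nbhd R); split; first by exists (@chartV R); [exact: chartV_open|].
split.
  apply/nbhdP; exists (0, 0); last by rewrite Tm_T_X.
  by split; rewrite /= normr0 radius_gt0.
split.
  move=> T /nbhdP[p pb ->]; rewrite wilkinson_Tm//; apply/nbhdP.
  by exists (step p) => //; exact: step_box.
split; first exact: wilkinson_rates.
move=> X; split.
  exists (@arc R); split; [exact: arc_is_arc|exact: arc_union|exact: arc_disjoint|exact: arc_wilkinson].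
apply: hausdorff_dim_eq1.
- exact: limit_X_measure_eq0.
- exact: limit_X_measure_neq0.
Qed.
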